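(* Let $\Omega \subset \mathbb{R}^2$ be an open set, let $u:\Omega\to\mathbb{R}$ be a semiconcave function on $\Omega$, and let $x_0 \in \Sigma(u)$ be a singular point of $u$ such that $$\partial D^+ u(x_0) \setminus D^* u(x_0) \neq \emptyset .$$ Then there exist a Cartesian coordinate system in $\mathbb{R}^2$ given by a map $A:\mathbb{R}^2\to \mathbb{R}^2$ such that $A(x_0)=(0,0)$, a number $\alpha>0$, and convex Lipschitz functions $y_1, y_2 : [0,\alpha]\to\mathbb{R}$ such that, denoting $\psi(x):= (x,\, y_1(x)-y_2(x))$ for $x \in [0,\alpha]$, we have $\psi(0) = (0,0)$ and $A^{-1}(\psi([0,\alpha])) \subset \Sigma(u)$.
   Context: Semiconcavity is understood in the (local, linear) sense: a function $u$ on an open set $\Omega\subset\mathbb{R}^n$ is semiconcave if it is locally representable in the form $u(x)=g(x)+K\|x\|^2$ with $g$ concave; that is, for every point of $\Omega$ there are an open ball $B\subset\Omega$ centered at that point, a constant $K\in\mathbb{R}$ and a concave function $g$ on $B$ such that $u(x)=g(x)+K\|x\|^2$ for all $x\in B$. Such a function is locally Lipschitz, hence differentiable almost everywhere in $\Omega$. The singular set of $u$ is $\Sigma(u)=\{x\in\Omega : u \text{ is not (Fréchet) differentiable at } x\}$; its elements are the singular points of $u$. The (Fréchet) derivative $Du(x)$ is regarded as an element of $\mathbb{R}^n$ (the gradient). For $x\in\Omega$, the set of reachable gradients of $u$ at $x$ is $$D^*u(x)=\{p\in\mathbb{R}^n : \text{there is a sequence } (x_i) \text{ in } \Omega \text{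 of points of differentiability of } u \text{ with } x_i\to x \text{ and } Du(x_i)\to p\}.$$ The superdifferential of $u$ at $x$ is $D^+u(x)=\operatorname{conv} D^*u(x)$, the convex hull of $D^*u(x)$. The symbol $\partial D^+u(x)$ denotes the topological boundary of the set $D^+u(x)$ in $\mathbb{R}^n$. A Cartesian coordinate system in $\mathbb{R}^2$ given by a map $A:\mathbb{R}^2\to\mathbb{R}^2$ means that $A$ is a bijective Euclidean isometry of $\mathbb{R}^2$, sending each point to its coordinates in an orthonormal coordinate system with some origin. *)

(* Defs.v *)
From mathcomp Require Import all_boot all_order all_algebra.
From mathcomp Require Import all_classical all_reals all_analysis.

Set Implicit Arguments.
Unset Strict Implicit.
Unset Printing Implicit Defensive.

Import Order.TTheory GRing.Theory Num.Theory.
Import numFieldNormedType.Exports.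

Local Open Scope classical_set_scope.
Local Open Scope ring_scope.

(* R^n is 'rV[R]_n. A function on an open set Omega is a total function on    *)
(* 'rV[R]_n: all notions below depend only on its values on Omega, because    *)
(* differentiability at a point is local.                                     *)

(* The norm `|v| of 'rV[R]_n is the sup norm. It has the same topology and    *)
(* the same differentiable functions as the Euclidean norm, but balls,        *)
(* squared norms and isometries have to be Euclidean.                         *)
Definition enorm (R : realType) (n : nat) (v : 'rV[R]_n) : R :=
  Num.sqrt (\sum_i v 0 i ^+ 2).

Definition eball (R : realType) (n : nat) (c : 'rV[R]_n) (r : R) :
  set 'rV[R]_n := [set x | enorm (x - c) < r].

Definition concave_on (R : realType) (n : nat) (B : set 'rV[R]_n)
  (g : 'rV[R]_n -> R) : Prop := convex_function B (fun x => - g x).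

Definition semiconcave (R : realType) (n : nat) (Omega : set 'rV[R]_n)
    (u : 'rV[R]_n -> R) : Prop :=
  forall c, Omega c ->
    exists (r K : R) (g : 'rV[R]_n -> R),
      [/\ 0 < r,
          eball c r `<=` Omega,
          concave_on (eball c r) g
        & forall x, eball c r x -> u x = g x + K * enorm x ^+ 2].

Definition singular_set (R : realType) (n : nat) (Omega : set 'rV[R]_n)
    (u : 'rV[R]_n -> R) : set 'rV[R]_n :=
  [set x | Omega x /\ ~ differentiable u x].

Definition grad (R : realType) (n : nat) (u : 'rV[R]_n -> R) (x : 'rV[R]_n) :
    'rV[R]_n :=
  \row_i 'd u x (delta_mx 0 i).

Definition reachable_gradients (R : realType) (n : nat)
    (Omega : set 'rV[R]_n) (u : 'rV[R]_n -> R) (x : 'rV[R]_n) :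
    set 'rV[R]_n :=
  [set p | exists x_ : nat -> 'rV[R]_n,
     [/\ forall i, Omega (x_ i) /\ differentiable u (x_ i),
         x_ i @[i --> \oo] --> x
       & grad u (x_ i) @[i --> \oo] --> p]].

Definition convex_hull (R : realType) (n : nat) (S : set 'rV[R]_n) :
    set 'rV[R]_n :=
  smallest (@convex_set R 'rV[R]_n) S.

Definition superdifferential (R : realType) (n : nat) (Omega : set 'rV[R]_n)
    (u : 'rV[R]_n -> R) (x : 'rV[R]_n) : set 'rV[R]_n :=
  convex_hull (reachable_gradients Omega u x).

Definition boundary (R : realType) (n : nat) (S : set 'rV[R]_n) :
  set 'rV[R]_n := closure S `\` interior S.

Definition cartesian_coordinates (R : realType) (n : nat)
    (A : 'rV[R]_n -> 'rV[R]_n) : Prop :=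
  bijective A /\ forall x y, enorm (A x - A y) = enorm (x - y).

Definition point2 (R : realType) (a b : R) : 'rV[R]_2 :=
  \row_(i < 2) [:: a; b]`_i.

(* Main.v *)
From HB Require Import structures.
Require Import Defs.
From mathcomp Require Import all_boot all_order all_algebra.
From mathcomp Require Import all_classical all_reals all_analysis.
From mathcomp Require Import ring lra.

Set Implicit Arguments.
Unset Strict Implicit.
Unset Printing Implicit Defensive.

Import Order.TTheory GRing.Theory Num.Theory.
Import numFieldNormedType.Exports.

Local Open Scope classical_set_scope.
Local Open Scope ring_scope.

(** Subtract u from a paraboloid and add a linear function: near x0 this gives a
    convex function f, with the same points of differentiability as u, and a
    point p of the boundary of the superdifferential that is not a reachable
    gradient of u becomes the vector 0. So 0 lies on the boundary of the
    subdifferential of f at x0 without being a limit of gradients of f. Let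
    theta be an outer normal of the subdifferential at 0
    ([supporting_direction]). As the set of limit gradients is compact, 0 lies
    between two of them on the face orthogonal to theta ([face_point]), both at
    distance at least e from 0.

    Use coordinates (t, s) along theta and its perpendicular, with x0 as
    origin, and write f as h(t, s). At points of a thin cone |s| <= delta t the
    gradients of h are close to the face, and none is close to 0; so their
    second components avoid an interval around 0 ([vertical_gap_above_cone]).
    Since gradients exist on a dense set ([convex_gradient_dense]), the convex
    function h(t, .) has a sharp minimum at some phi(t): it grows at least like
    c |s - phi(t)| with c proportional to e ([sharp_minimum]). Hence f has a
    kink at (t, phi(t)), and the graph of phi consists of singular points.

    The sharp minimum also shows that phi is a difference of convex functions:
    h(t, s) + c s and h(t, s) - c s are both minimal at s = phi(t), so
    h(t, phi(t)) + c phi(t) and h(t, phi(t)) - c phi(t) are partial minima over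
    a convex cone of functions that are jointly convex, hence convex in t, and
    they differ by 2 c phi(t) ([ridge_difference_of_convex]). *)

(** * Scalar product and compactness *)

Lemma lipschitz_within_continuous (R : realType) (V : normedModType R)
    (D : set V) (g : V -> R) (L : R) :
  (forall x y, D x -> D y -> `|g x - g y| <= L * `|x - y|) ->
  {within D, continuous g}.
Proof.
move=> gL; have L1 : 0 < `|L| + 1 by rewrite ltr_pwDr.
rewrite continuous_subspace_in => x; rewrite inE => Dx.
apply/(@cvgrPdist_le _ R) => e e0.
rewrite -nbhs_subspace_in//; near=> y => /=.
apply: le_trans (gL _ _ Dx _) _; first by near: y; exact: withinT.
have : `|x - y| <= e / (`|L| + 1).
  near: y; apply: cvg_within; apply: (@cvgr_dist_le _ _ _ _ _ id x) => //.
  by rewrite divr_gt0.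
rewrite ler_pdivlMr// => xy; apply: le_trans xy; rewrite mulrC ler_wpM2l//.
by rewrite (le_trans (ler_norm _))// lerDl.
Unshelve. all: by end_near. Qed.

Lemma lipschitzT_continuous (R : realType) (V : normedModType R)
    (g : V -> R) (L : R) :
  (forall x y, `|g x - g y| <= L * `|x - y|) -> continuous g.
Proof.
move=> gL; apply/continuous_subspace_setT.
by apply: lipschitz_within_continuous => x y _ _; exact: gL.
Qed.

Section Dot.
Variables (R : realType) (n : nat).
Implicit Types u v w : 'rV[R]_n.

Definition dot u v : R := \sum_i u 0 i * v 0 i.

Lemma dotC u v : dot u v = dot v u.
Proof. by apply: eq_bigr => i _; rewrite mulrC. Qed.

Lemma dotDr u v w : dot u (v + w) = dot u v + dot u w.
Proof. by rewrite -big_split; apply: eq_bigr => i _; rewrite mxE mulrDr. Qed.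

Lemma dotZr u (a : R) v : dot u (a *: v) = a * dot u v.
Proof. by rewrite mulr_sumr; apply: eq_bigr => i _; rewrite mxE mulrCA. Qed.

Lemma dotDl u v w : dot (u + v) w = dot u w + dot v w.
Proof. by rewrite dotC dotDr !(dotC w). Qed.

Lemma dotZl (a : R) u v : dot (a *: u) v = a * dot u v.
Proof. by rewrite dotC dotZr dotC. Qed.

Lemma dotNr u v : dot u (- v) = - dot u v.
Proof. by rewrite -scaleN1r dotZr mulN1r. Qed.

Lemma dotNl u v : dot (- u) v = - dot u v.
Proof. by rewrite dotC dotNr dotC. Qed.

Lemma dotBr u v w : dot u (v - w) = dot u v - dot u w.
Proof. by rewrite dotDr dotNr. Qed.

Lemma dotBl u v w : dot (u - v) w = dot u w - dot v w.
Proof. by rewrite dotDl dotNl. Qed.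

Lemma dot0r u : dot u 0 = 0.
Proof. by rewrite -(scale0r 0) dotZr mul0r. Qed.

Lemma dot_ge0 u : 0 <= dot u u.
Proof. by apply: sumr_ge0 => i _; rewrite -expr2 sqr_ge0. Qed.

Lemma coord_le_norm u i : `|u 0 i| <= `|u|.
Proof.
rewrite [leRHS]/Num.norm /= mx_normrE.
exact: (@le_bigmax _ _ _ _ (fun ij => `|u ij.1 ij.2|) (0, i)).
Qed.

Lemma norm_le_coord u (r : R) :
  0 <= r -> (forall i, `|u 0 i| <= r) -> `|u| <= r.
Proof.
move=> r0 ur; rewrite [leLHS]/Num.norm /= mx_normrE.
apply/bigmax_leP; split=> //= -[i j] _ /=.
by rewrite (ord1 i); exact: ur.
Qed.

Lemma dot_le_norm u v : `|dot u v| <= n%:R * (`|u| * `|v|).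
Proof.
apply: (le_trans (ler_norm_sum _ _ _)).
have -> : n%:R * (`|u| * `|v|) = \sum_(i < n) `|u| * `|v|.
  by rewrite sumr_const card_ord mulr_natl.
apply: ler_sum => i _.
by rewrite normrM ler_pM// coord_le_norm.
Qed.

Lemma dot_eq0 u : (dot u u == 0) = (u == 0).
Proof.
apply/idP/eqP => [|->]; last by rewrite dot0r.
rewrite psumr_eq0 => [/allP u0|i _]; last by rewrite -expr2 sqr_ge0.
apply/rowP => i; rewrite mxE; have /implyP/(_ isT) := u0 i (mem_index_enum _).
by rewrite mulf_eq0 orbb => /eqP.
Qed.

Lemma dot_delta u i : dot u (delta_mx 0 i) = u 0 i.
Proof.
rewrite /dot (bigD1 i)//= mxE !eqxx mulr1 big1 ?addr0// => j ji.
by rewrite mxE (negbTE ji) andbF mulr0.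
Qed.

Lemma norm_le_dual u (L : R) :
  0 <= L -> (forall v, `|dot u v| <= L * `|v|) -> `|u| <= L.
Proof.
move=> L0 uL; apply: norm_le_coord => // i.
have := uL (delta_mx 0 i); rewrite dot_delta => /le_trans; apply.
rewrite ler_piMr//; apply: norm_le_coord => // j; rewrite mxE eqxx /=.
by case: (j == i); rewrite ?normr1 ?normr0.
Qed.

Lemma norm_sqr_le_dot u : `|u| ^+ 2 <= dot u u.
Proof.
rewrite -[leRHS]sqr_sqrtr ?dot_ge0// ler_sqr ?nnegrE ?sqrtr_ge0//.
apply: norm_le_coord; rewrite ?sqrtr_ge0// => i.
rewrite -ler_sqr ?nnegrE ?sqrtr_ge0// sqr_sqrtr ?dot_ge0//.
rewrite real_normK ?num_real//.
rewrite /dot (bigD1 i)//= expr2 lerDl sumr_ge0// => j _.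
by rewrite -expr2 sqr_ge0.
Qed.

Lemma enorm_sqr u : enorm u ^+ 2 = dot u u.
Proof.
by rewrite sqr_sqrtr; [apply: eq_bigr => i _; rewrite expr2|
  apply: sumr_ge0 => i _; exact: sqr_ge0].
Qed.

Lemma continuous_dot u : continuous (dot u).
Proof.
apply: lipschitzT_continuous (n%:R * `|u|) _ => v w.
by rewrite -dotBr -mulrA dot_le_norm.
Qed.

Lemma sqr_dist_lipschitz z (p : R) u v : `|u - z| <= p -> `|v - z| <= p ->
  `|dot (u - z) (u - z) - dot (v - z) (v - z)| <= n%:R * (2 * p) * `|u - v|.
Proof.
move=> uz vz.
rewrite (_ : _ - _ = dot (u - v) ((u - z) + (v - z))); last first.
  rewrite (_ : u - v = (u - z) - (v - z)); last by rewrite opprB addrA subrK.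
  by move: (u - z) (v - z) => a b; rewrite dotBl !dotDr (dotC b a); ring.
apply: le_trans (dot_le_norm _ _) _.
rewrite -[leRHS]mulrA ler_wpM2l// mulrC ler_wpM2r//.
by apply: le_trans (ler_normD _ _) _; lra.
Qed.

Lemma compact_closed_ball z (p : R) : compact [set u : 'rV[R]_n | `|u - z| <= p].
Proof.
apply: bounded_closed_compact.
  exists (p + `|z|); split; first exact: num_real.
  move=> M pM u /= uz; rewrite -(subrK z u).
  by apply: le_trans (ler_normD _ _) _; lra.
rewrite (_ : mkset _ = (fun u : 'rV[R]_n => `|u - z|) @^-1` [set x | x <= p])//.
apply: preimage_closed; last exact: closed_le.
move=> u _; move: u; apply: (@lipschitzT_continuous _ _ _ 1) => u v.
rewrite mul1r; apply: le_trans (ler_dist_dist _ _) _.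
by rewrite opprB addrA subrK.
Qed.

(** The form of sequential compactness in use below: approximate solutions of
    a condition P that tightens as e tends to 0 accumulate at some q. *)
Lemma compact_approx (K : set 'rV[R]_n) (P : R -> set 'rV[R]_n) :
  compact K -> (forall e e' q, e <= e' -> P e q -> P e' q) ->
  (forall e, 0 < e -> exists2 q, K q & P e q) ->
  exists2 q, K q &
    forall e, 0 < e -> exists q', [/\ K q', `|q' - q| < e & P e q'].
Proof.
move=> cK Pmon Pex.
pose F := filter_from [set e : R | 0 < e] (fun e => K `&` P e).
have FF : ProperFilter F.
  apply: filter_from_proper => [|e /Pex[q Kq Pq]]; last by exists q.
  apply: filter_from_filter; first by exists 1; exact: ltr01.
  move=> e1 e2 /= e10 e20; exists (Num.min e1 e2); first by rewrite lt_min e10.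
  move=> q [Kq Pq]; split; split=> //; apply: Pmon Pq.
    by rewrite ge_min lexx.
  by rewrite ge_min lexx orbT.
have [|q [Kq clq]] := cK F FF; first by exists 1; [exact: ltr01|move=> q []].
exists q => // e e0.
have [||q' [[Kq' Pq'] qq']] := clq (K `&` P e) (ball q e).
- by exists e.
- exact: nbhsx_ballx.
by exists q'; split=> //; rewrite distrC; move: qq'; rewrite -ball_normE.
Qed.

End Dot.

(** * Gradients and their limits *)

Section Gradient.
Variables (R : realType) (n : nat).
Implicit Types (f : 'rV[R]_n -> R) (x G : 'rV[R]_n).

(** Frechet differentiability at x with gradient G, with explicit epsilon and
    delta, the form in which it is combined with convexity inequalities. *)
Definition isgrad f x G := forall e : R, 0 < e -> exists2 d : R, 0 < d &
  forall h, `|h| < d -> `|f (x + h) - f x - dot G h| <= e * `|h|.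

Lemma dot_linear G : linear (dot G : 'rV[R]_n -> R).
Proof. by move=> a u v; rewrite dotDr dotZr. Qed.

HB.instance Definition _ G :=
  GRing.isLinear.Build R 'rV[R]_n R _ (dot G) (dot_linear G).

Lemma dot_deltaE (l : {linear 'rV[R]_n -> R}) h :
  l h = dot (\row_i l (delta_mx 0 i)) h.
Proof.
rewrite {1}(row_sum_delta h) linear_sum; apply: eq_bigr => i _.
by rewrite linearZ mxE mulrC.
Qed.

Lemma isgradP f x G : isgrad f x G <-> differentiable f x /\ grad f x = G.
Proof.
split=> [fG|[df <-]].
  have dl : continuous (dot G) by exact: continuous_dot.
  have [dE df] : 'd f x = dot G :> ('rV[R]_n -> R) /\ differentiable f x.
    have dP := diff_locallyP x f.
    have H := @diff_unique R 'rV[R]_n R f (dot G) x dl.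
    match type of H with ?P -> _ => have fo : P end.
      apply/eqaddoP => e e0; have [d d0 fGd] := fG e e0.
      have : nbhs (0 : 'rV[R]_n) [set h | `|h| < d].
        by apply/nbhs_ballP; exists d => //= h; rewrite -ball_normE /= sub0r normrN.
      by apply: filterS => h /= /fGd; rewrite !fctE opprD addrA (addrC x).
    by have dE := H fo; split=> //; apply/dP; rewrite dE.
  by split=> //; apply/rowP => i; rewrite mxE dE dot_delta.
move=> e e0; have /diff_locally/eqaddoP/(_ e e0) fo := df.
have /nbhs_ballP[d /= d0 fd] : nbhs (0 : 'rV[R]_n) [set h |
    `|f (x + h) - f x - dot (grad f x) h| <= e * `|h|].
  apply: filterS fo => h /=; rewrite !fctE opprD addrA (addrC h).
  by rewrite (dot_deltaE ('d f x)).
by exists d => // h hd; apply: fd; rewrite -ball_normE /= sub0r normrN.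
Qed.

(** The scale k below shrinks v into the region where both the Lipschitz bound
    and the first-order expansion hold. *)
Lemma isgrad_norm_le (f : 'rV[R]_n -> R) x G (L d : R) : 0 < d -> 0 <= L ->
  (forall h, `|h| < d -> `|f (x + h) - f x| <= L * `|h|) ->
  isgrad f x G -> forall v, `|dot G v| <= L * `|v|.
Proof.
move=> d0 L0 fL fG v; have [->|v0] := eqVneq v 0.
  by rewrite dot0r !normr0 mulr0.
have nv : 0 < `|v| by rewrite normr_gt0.
apply/ler_addgt0Pr => e e0.
have [d' d'0 H] := fG (e / `|v|) (divr_gt0 e0 nv).
pose k := Num.min d d' / (2 * `|v|).
have m0 : 0 < Num.min d d' by rewrite lt_min d0.
have k0 : 0 < k by rewrite divr_gt0// mulr_gt0.
have kv : `|k *: v| = Num.min d d' / 2.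
  by rewrite normrZ gtr0_norm// /k; field; rewrite lt0r_neq0.
have kvd : `|k *: v| < Num.min d d' by rewrite kv; lra.
have [kd kd'] : `|k *: v| < d /\ `|k *: v| < d'.
  by move: kvd; rewrite lt_min => /andP[].
have := H _ kd'; have := fL _ kd.
rewrite normrZ gtr0_norm// dotZr => A B.
have : `|k * dot G v| <= L * (k * `|v|) + e / `|v| * (k * `|v|).
  rewrite (_ : k * dot G v = (f (x + k *: v) - f x) -
    (f (x + k *: v) - f x - k * dot G v)); last by ring.
  exact: le_trans (ler_normB _ _) (lerD A B).
rewrite normrM gtr0_norm// (_ : _ + _ = k * (L * `|v| + e)).
  by rewrite ler_pM2l.
by field; rewrite lt0r_neq0.
Qed.

(** The reachable gradients of f at x0, without sequences: the pair (x0, q) is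
    adherent to the graph of the gradient. *)
Definition limgrad f x0 q := forall e : R, 0 < e ->
  exists x G, [/\ `|x - x0| < e, isgrad f x G & `|G - q| < e].

End Gradient.

(** * Convex functions *)

Section Convex.
Variable R : realType.

Lemma convex_comb_lt (a b e t : R) :
  a < e -> b < e -> 0 <= t <= 1 -> t * a + (1 - t) * b < e.
Proof.
move=> ae be /andP[t0 t1].
have A1 : t * (e - a) + (1 - t) * (e - b) > 0; last lra.
have [t05|t05] := leP t 2^-1.
  by rewrite ltr_wpDl// ?mulr_ge0 ?mulr_gt0//; lra.
by rewrite ltr_wpDr// ?mulr_ge0 ?mulr_gt0//; lra.
Qed.


Lemma convex_functionP (E : lmodType R) (D : set E) (f : E -> R) :
  convex_function D f <->
  (forall x y t, D x -> D y -> 0 <= t <= 1 ->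
    f (t *: x + (1 - t) *: y) <= t * f x + (1 - t) * f y).
Proof.
split=> [cf x y t Dx Dy /andP[t0 t1]|cf t x y /[!inE] Dx Dy].
  exact: (cf (Itv01 t0 t1) x y (mem_set Dx) (mem_set Dy)).
by apply: cf => //; rewrite ge0 le1.
Qed.

Variable n : nat.
Implicit Types (D : set 'rV[R]_n) (f : 'rV[R]_n -> R) (c x y z G : 'rV[R]_n).

Lemma in_ball c (r : R) x : ball c r x <-> `|x - c| < r.
Proof. by rewrite -ball_normE /= distrC. Qed.

Lemma ball_convex c x y (r t : R) :
  ball c r x -> ball c r y -> 0 <= t <= 1 -> ball c r (t *: x + (1 - t) *: y).
Proof.
move=> /in_ball xc /in_ball yc t01; apply/in_ball.
rewrite (_ : _ - c = t *: (x - c) + (1 - t) *: (y - c)); last first.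
  by apply/rowP => i; rewrite !mxE; ring.
apply: le_lt_trans (ler_normD _ _) _; rewrite !normrZ.
case/andP: (t01) => t0 t1; rewrite (ger0_norm t0).
rewrite (@ger0_norm _ (1 - t)) ?subr_ge0//; exact: convex_comb_lt.
Qed.

(** Compare the first-order expansion of f at x with its chord from x to y, at
    a point t of the way, and divide by t. *)
Lemma convex_subgradient D f x y G :
  convex_function D f -> D x -> D y -> isgrad f x G ->
  f x + dot G (y - x) <= f y.
Proof.
move=> /convex_functionP cf Dx Dy fG; apply/ler_addgt0Pr => e e0.
have n0 : 0 < `|y - x| + 1 by rewrite ltr_pwDr.
have [d d0 H] := fG _ (divr_gt0 e0 n0).
pose t := Num.min 1 (d / (2 * (`|y - x| + 1))).
have t0 : 0 < t by rewrite lt_min ltr01 divr_gt0// mulr_gt0.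
have t1 : t <= 1 by rewrite ge_min lexx.
have td : t * `|y - x| < d.
  have : t <= d / (2 * (`|y - x| + 1)) by rewrite ge_min lexx orbT.
  rewrite ler_pdivlMr ?mulr_gt0// => A.
  have : 0 <= t * `|y - x| by rewrite mulr_ge0// ltW.
  lra.
have tn : `|t *: (y - x)| = t * `|y - x| by rewrite normrZ gtr0_norm.
have := H (t *: (y - x)); rewrite tn => /(_ td).
rewrite dotZr ler_norml => /andP[A _].
have := cf y x t Dy Dx; rewrite (ltW t0) t1 => /(_ isT).
rewrite (_ : t *: y + (1 - t) *: x = x + t *: (y - x)); last first.
  by apply/rowP => i; rewrite !mxE; ring.
move=> B; rewrite -(ler_pM2l t0).
have C : e / (`|y - x| + 1) * (t * `|y - x|) <= t * e.
  rewrite mulrAC ler_pdivrMr// mulrCA -mulrA ler_pM2l// ler_pM2l//; lra.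
lra.
Qed.

(** Prolong the segment from x to y by the length r up to a point z of the
    larger ball: on the segment from x to z the slope of f is at most the
    oscillation 2 M over r. *)
Lemma convex_bounded_lipschitz f c (r M : R) : 0 < r ->
  convex_function (ball c (2 * r)) f ->
  (forall x, ball c (2 * r) x -> `|f x| <= M) ->
  forall x y, ball c r x -> ball c r y ->
  `|f x - f y| <= 2 * M / r * `|x - y|.
Proof.
move=> r0 /convex_functionP cf fM.
suff half x y : ball c r x -> ball c r y ->
    f y - f x <= 2 * M / r * `|x - y|.
  move=> x y bx by'; rewrite ler_norml; have := half x y bx by'.
  have := half y x by' bx; rewrite distrC; lra.
move=> bx by'; have [->|xy] := eqVneq x y; first by rewrite !subrr normr0 mulr0.
have p0 : 0 < `|x - y| by rewrite normr_gt0 subr_eq0.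
move: bx by' => /in_ball bx /in_ball by'.
set p := `|x - y| in p0 *.
pose z := y + (r / p) *: (y - x).
have bz : `|z - c| < 2 * r.
  rewrite /z (_ : _ - c = (y - c) + (r / p) *: (y - x)); last first.
    by rewrite addrAC.
  apply: le_lt_trans (ler_normD _ _) _.
  rewrite normrZ (distrC y x) -/p gtr0_norm ?divr_gt0// divfK ?gt_eqF//; lra.
have xb : ball c (2 * r) x by apply/in_ball; lra.
have zb : ball c (2 * r) z by apply/in_ball.
pose t := p / (r + p).
have rp : 0 < r + p by rewrite addr_gt0.
have t0 : 0 <= t by rewrite divr_ge0// ltW.
have t1 : t <= 1 by rewrite ler_pdivrMr// mul1r lerDr ltW.
have := cf z x t zb xb; rewrite t0 t1 => /(_ isT).
rewrite (_ : t *: z + (1 - t) *: x = y); last first.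
  apply/rowP => i; rewrite !mxE /t; field.
  by rewrite !gt_eqF.
move=> A.
have B : f z - f x <= 2 * M.
  move: (fM _ zb) (fM _ xb); rewrite !ler_norml => /andP[? ?] /andP[? ?]; lra.
have M0 : 0 <= M by exact: le_trans (fM _ xb).
apply: (@le_trans _ _ (t * (2 * M))).
  have := ler_wpM2l t0 B; lra.
rewrite (_ : _ * p = p / r * (2 * M)); last by ring.
by rewrite ler_wpM2r ?mulr_ge0// ler_pM2l// lef_pV2 ?posrE// lerDl ltW.
Qed.

(** A convex function has a supporting hyperplane from below at interior points,
    so touching it from above by a paraboloid forces a gradient. Sliding a
    steep paraboloid centred at z along the graph yields such points as close
    to z as desired, so no almost everywhere differentiability theorem is
    involved. *)
Lemma convex_gradient_dense f c (r L : R) z (e : R) : 0 <= L ->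
  convex_function (ball c r) f ->
  (forall x y, ball c r x -> ball c r y -> `|f x - f y| <= L * `|x - y|) ->
  ball c r z -> 0 < e -> exists x G, `|x - z| < e /\ isgrad f x G.
Proof.
move=> L0 /convex_functionP cf fL /in_ball bz e0.
(* x will be sought in the closed ball of radius p about z; the opening lam
   of the paraboloid is large enough to keep x away from its boundary. *)
pose p := Num.min e (r - `|z - c|) / 2.
have m0 : 0 < Num.min e (r - `|z - c|) by rewrite lt_min e0 subr_gt0.
have p0 : 0 < p by rewrite divr_gt0.
have pm : p < Num.min e (r - `|z - c|) by rewrite /p; lra.
have [pe pr] : p < e /\ p < r - `|z - c| by move: pm; rewrite lt_min => /andP[].
pose K := [set x | `|x - z| <= p].
have Kb x : K x -> ball c r x.
  move=> Kx; apply/in_ball; rewrite -(subrKA z).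
  by apply: le_lt_trans (ler_normD _ _) _; rewrite /K /= in Kx; lra.
pose lam := (L + 1) / p.
have lam0 : 0 < lam by rewrite divr_gt0// ltr_wpDl.
pose phi x := lam * dot (x - z) (x - z) - f x.
have phiL x y : K x -> K y ->
    `|phi x - phi y| <= (lam * (n%:R * (2 * p)) + L) * `|x - y|.
  move=> Kx Ky.
  rewrite (_ : phi x - phi y = lam * (dot (x - z) (x - z) -
    dot (y - z) (y - z)) - (f x - f y)); last by rewrite /phi; ring.
  apply: le_trans (ler_normB _ _) _; rewrite mulrDl lerD ?fL//; try exact: Kb.
  by rewrite normrM gtr0_norm// -mulrA ler_pM2l// sqr_dist_lipschitz.
have cK : compact K by exact: compact_closed_ball.
have [|x] := EVT_min_rV _ cK (lipschitz_within_continuous phiL).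
  by exists z; rewrite /K /= subrr normr0 ltW.
rewrite inE => Kx xmin.
have xz : `|x - z| < p.
  have Kz : K z by rewrite /K /= subrr normr0 ltW.
  have := xmin z (mem_set Kz); rewrite /phi subrr dot0r mulr0 sub0r => A.
  have B := norm_sqr_le_dot (x - z).
  have : f x - f z <= L * `|x - z|.
    by apply: le_trans (ler_norm _) _; apply: fL; apply: Kb.
  move=> C; rewrite ltNge; apply/negP => pxz.
  have nz : 0 < `|x - z| by apply: lt_le_trans pxz.
  have : lam * `|x - z| ^+ 2 <= L * `|x - z|.
    by have := ler_wpM2l (ltW lam0) B; lra.
  rewrite expr2 mulrA ler_pM2r//.
  have : L + 1 <= lam * `|x - z|.
    by rewrite /lam mulrAC ler_pdivlMr// ler_wpM2l// addr_ge0.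
  lra.
exists x, ((2 * lam) *: (x - z)); split; first lra.
have upper (h : 'rV[R]_n) : `|h| < p - `|x - z| ->
    f (x + h) - f x <= 2 * lam * dot (x - z) h + lam * dot h h.
  move=> hd.
  have Kxh : K (x + h).
    rewrite /K /= addrAC; apply: le_trans (ler_normD _ _) _.
    by rewrite -lerBrDl ltW.
  have := xmin _ (mem_set Kxh).
  rewrite /phi addrAC; move: (x - z) => a.
  by rewrite !(dotDl, dotDr) (dotC h a); lra.
move=> eps eps0.
have ln0 : 0 < lam * n%:R + 1 by rewrite ltr_wpDl// mulr_ge0// ltW.
exists (Num.min (p - `|x - z|) (eps / (lam * n%:R + 1))).
  by rewrite lt_min subr_gt0 xz divr_gt0.
move=> h; rewrite lt_min => /andP[hd he].
have A := upper h hd.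
have := upper (- h); rewrite normrN => /(_ hd); rewrite !dotNr dotNl => B.
have Kh (k : 'rV[R]_n) : `|k| < p - `|x - z| -> ball c r (x + k).
  move=> kd; apply: Kb; rewrite /K /= addrAC.
  by apply: le_trans (ler_normD _ _) _; lra.
(* The upper bound at x - h and convexity give the lower bound at x + h. *)
have := cf (x + h) (x - h) 2^-1 (Kh _ hd).
have -> : 2^-1 *: (x + h) + (1 - 2^-1) *: (x - h) = x.
  by apply/rowP => i; rewrite !mxE; field.
move=> C; have {}C : 2 * f x <= f (x + h) + f (x - h).
  have : f x <= 2^-1 * f (x + h) + (1 - 2^-1) * f (x - h).
    by apply: C; [apply: Kh; rewrite normrN|lra].
  lra.
have D : lam * dot h h <= eps * `|h|.
  have : lam * dot h h <= lam * (n%:R * (`|h| * `|h|)).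
    by rewrite ler_pM2l//; apply: le_trans (ler_norm _) (dot_le_norm _ _).
  move=> /le_trans; apply; rewrite !mulrA ler_wpM2r//.
  move: he; rewrite ltr_pdivlMr// => he.
  by have := normr_ge0 h; lra.
rewrite dotZl ler_norml; lra.
Qed.

End Convex.

Lemma ord2P (i : 'I_2) : i = 0 \/ i = 1.
Proof. by case: i => -[|[|//]] ?; [left|right]; apply: val_inj. Qed.

(** A point of a small ball is the midpoint of two points on the coordinate
    cross through the centre, and on this cross f is bounded by its values at
    the four tips; reflection in the centre then gives the lower bound. *)
Lemma convex_locally_bounded (R : realType) (f : 'rV[R]_2 -> R) c (r : R) :
  0 < r -> convex_function (ball c r) f ->
  exists M, forall x, ball c (r / 4) x -> `|f x| <= M.
Proof.
move=> r0 /convex_functionP cf.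
pose tip i (s : R) : 'rV[R]_2 := c + s *: delta_mx 0 i.
have tipb i s : `|s| < r -> ball c r (tip i s).
  move=> sr; apply/in_ball; rewrite /tip addrC addKr.
  apply: le_lt_trans sr; apply: norm_le_coord => // j; rewrite !mxE eqxx /=.
  by case: (j == i); rewrite ?mulr1// mulr0 normr0.
pose m := `|f (tip 0 (r / 2))| + `|f (tip 0 (- (r / 2)))| +
          (`|f (tip 1 (r / 2))| + `|f (tip 1 (- (r / 2)))|).
have cross i s : `|s| <= r / 2 -> f (tip i s) <= m.
  rewrite ler_norml => /andP[s1 s2].
  have := cf (tip i (r / 2)) (tip i (- (r / 2))) ((s + r / 2) / r).
  have -> : ((s + r / 2) / r) *: tip i (r / 2) +
      (1 - (s + r / 2) / r) *: tip i (- (r / 2)) = tip i s.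
    by apply/rowP => j; rewrite !mxE; field; rewrite gt_eqF.
  set t := (s + r / 2) / r => H.
  have t0 : 0 <= t by rewrite divr_ge0//; lra.
  have t1 : t <= 1 by rewrite ler_pdivrMr//; lra.
  apply: le_trans (H _ _ _) _.
  - by apply: tipb; rewrite gtr0_norm; lra.
  - by apply: tipb; rewrite normrN gtr0_norm; lra.
  - by rewrite t0.
  have bd (a b : R) : t * a + (1 - t) * b <= `|a| + `|b|.
    have := ler_wpM2l t0 (ler_norm a).
    have := ler_wpM2l (_ : 0 <= 1 - t) (ler_norm b); rewrite subr_ge0 => /(_ t1).
    have := ler_wpM2r (normr_ge0 a) t1.
    have := mulr_ge0 t0 (normr_ge0 b).
    rewrite mulrBl !mul1r; lra.
  apply: le_trans (bd _ _) _.
  have := ler_norm (0 : R).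
  move: (normr_ge0 (f (tip 0 (r / 2)))) (normr_ge0 (f (tip 0 (- (r / 2)))))
    (normr_ge0 (f (tip 1 (r / 2)))) (normr_ge0 (f (tip 1 (- (r / 2))))).
  by have [->|->] := ord2P i; rewrite /m; lra.
have up x : ball c (r / 4) x -> f x <= m.
  move=> /in_ball xb.
  have xi i : `|2 * (x - c) 0 i| <= r / 2.
    rewrite normrM gtr0_norm//; have := coord_le_norm (x - c) i; lra.
  have := cf (tip 0 (2 * (x - c) 0 0)) (tip 1 (2 * (x - c) 0 1)) 2^-1.
  have -> : 2^-1 *: tip 0 (2 * (x - c) 0 0) + (1 - 2^-1) *: tip 1 (2 * (x - c) 0 1)
      = x.
    apply/rowP => j; rewrite !mxE.
    by have [->|->] := ord2P j; rewrite /=; field.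
  move=> H; apply: le_trans (H _ _ _) _.
  - by apply: tipb; have := xi 0; lra.
  - by apply: tipb; have := xi 1; lra.
  - lra.
  have := cross 0 _ (xi 0); have := cross 1 _ (xi 1); lra.
exists (m + 2 * `|f c|) => x xb; rewrite ler_norml.
have := up x xb; have [nfc fcn] : - `|f c| <= f c /\ f c <= `|f c|.
  by have := lexx `|f c|; rewrite ler_norml => /andP[].
have yb : ball c (r / 4) (c - (x - c)).
  move: xb => /in_ball xb; apply/in_ball.
  by rewrite addrC addKr normrN.
have := up _ yb; have := cf x (c - (x - c)) 2^-1.
have -> : 2^-1 *: x + (1 - 2^-1) *: (c - (x - c)) = c.
  by apply/rowP => j; rewrite !mxE; field.
have sub y : ball c (r / 4) y -> ball c r y.
  by apply: le_ball; lra.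
move=> /(_ (sub _ xb) (sub _ yb)) H; have := normr_ge0 (f c).
have : f c <= 2^-1 * f x + (1 - 2^-1) * f (c - (x - c)) by apply: H; lra.
lra.
Qed.

(** * Supporting lines of convex hulls *)

Section ConvexSets.
Variables (R : realType) (n : nat).
Implicit Types (A C S : set 'rV[R]_n) (p q v w x y z : 'rV[R]_n).

Lemma le_of_small_error (a b k : R) : 0 <= k ->
  (forall e, 0 < e -> e <= 1 -> a <= b + e * k) -> a <= b.
Proof.
move=> k0 H; apply/ler_addgt0Pr => e e0.
have k1 : 0 < k + 1 by rewrite ltr_wpDl.
have := H (Num.min 1 (e / (k + 1))).
rewrite lt_min ltr01 divr_gt0// ge_min lexx => /(_ isT isT) /le_trans; apply.
rewrite lerD2l; apply: (@le_trans _ _ (e / (k + 1) * k)).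
  by rewrite ler_wpM2r// ge_min lexx orbT.
by rewrite mulrAC ler_pdivrMr// ler_pM2l// lerDl.
Qed.

Lemma convex_setP A : convex_set A <->
  (forall x y t, A x -> A y -> 0 <= t <= 1 -> A (t *: x + (1 - t) *: y)).
Proof.
split=> [cA x y t Ax Ay /andP[t0 t1]|cA x y t /[!inE] Ax Ay].
  by have := cA x y (Itv01 t0 t1) (mem_set Ax) (mem_set Ay); rewrite inE.
by apply: cA => //; rewrite ge0 le1.
Qed.

Lemma closure_normP A x :
  closure A x <-> forall e, 0 < e -> exists2 a, A a & `|a - x| < e.
Proof.
split=> [clA e e0|H B /nbhs_ballP[e /= e0 eB]].
  have [a [Aa xa]] := clA _ (nbhsx_ballx x e e0).
  by exists a => //; apply/in_ball.
by have [a Aa ax] := H e e0; exists a; split=> //; apply/eB/in_ball.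
Qed.

Lemma closure_convex C : convex_set C -> convex_set (closure C).
Proof.
move=> /convex_setP cC; apply/convex_setP => x y t.
move=> /closure_normP Cx /closure_normP Cy /andP[t0 t1].
apply/closure_normP => e e0.
have [a Ca ax] := Cx e e0; have [b Cb bY] := Cy e e0.
exists (t *: a + (1 - t) *: b); first by apply: cC => //; rewrite t0.
rewrite (_ : _ - _ = t *: (a - x) + (1 - t) *: (b - y)); last first.
  by apply/rowP => i; rewrite !mxE; ring.
apply: le_lt_trans (ler_normD _ _) _; rewrite !normrZ (ger0_norm t0).
rewrite (@ger0_norm _ (1 - t)) ?subr_ge0//.
by apply: convex_comb_lt => //; rewrite t0.
Qed.

Lemma convex_hull_convex S : convex_set (convex_hull S).
Proof.
apply/convex_setP => x y t Sx Sy t01 C [cC SC].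
by move/convex_setP : (cC); apply=> //; [apply: Sx|apply: Sy].
Qed.

Lemma sub_convex_hull S : S `<=` convex_hull S.
Proof. by move=> x Sx C [_]; exact. Qed.

Lemma convex_hull_min S C : convex_set C -> S `<=` C -> convex_hull S `<=` C.
Proof. by move=> cC SC x; apply. Qed.

(** The separating direction points to y from its nearest point in C. *)
Lemma separate_point C y : C !=set0 -> closed C -> convex_set C -> ~ C y ->
  exists v, v != 0 /\ forall c, C c -> dot (c - y) v < 0.
Proof.
move=> [a Ca] clC /convex_setP cC nCy.
(* Points farther than M from y are farther than a, so the nearest point can be
   sought in a compact set. *)
pose Q x := dot (x - y) (x - y).
pose M := Q a + 1.
have Qa0 : 0 <= Q a by exact: dot_ge0.
pose K := C `&` [set x | `|x - y| <= M].
have QL x x' : K x -> K x' -> `|Q x - Q x'| <= n%:R * (2 * M) * `|x - x'|.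
  by move=> [_ Kx] [_ Kx']; exact: sqr_dist_lipschitz.
have cK : compact K.
  by rewrite /K setIC; apply: compact_closedI => //; exact: compact_closed_ball.
have far x : M < `|x - y| -> Q a < Q x.
  move=> Mx; apply: lt_le_trans (norm_sqr_le_dot _).
  have M1 : 1 <= M by rewrite lerDr.
  apply: (@lt_le_trans _ _ M); first by rewrite ltrDl.
  apply: (@le_trans _ _ `|x - y|); first exact: ltW.
  by rewrite expr2 ler_peMl// (le_trans M1)// ltW.
have Ka : K a.
  by split=> //=; rewrite leNgt; apply/negP => /far; rewrite ltxx.
have [|z] := EVT_min_rV _ cK (lipschitz_within_continuous QL); first by exists a.
rewrite inE => -[Cz _] zK.
have zmin x : C x -> Q z <= Q x.
  move=> Cx; have [xM|/far Qx] := leP `|x - y| M.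
    by apply: zK; rewrite inE.
  by apply: le_trans (ltW Qx); apply: zK; rewrite inE.
have yz : y - z != 0.
  by rewrite subr_eq0; apply: contra_notN nCy => /eqP ->.
have v0 : 0 < dot (y - z) (y - z) by rewrite lt_neqAle eq_sym dot_eq0 yz dot_ge0.
exists (y - z); split=> // c Cc.
have cz : dot (c - z) (y - z) <= 0.
  apply: (@le_of_small_error _ _ (dot (c - z) (c - z))); first exact: dot_ge0.
  move=> e e0 e1; have := zmin (e *: c + (1 - e) *: z).
  have -> : Q (e *: c + (1 - e) *: z) =
      Q z - 2 * e * dot (c - z) (y - z) + e * e * dot (c - z) (c - z).
    rewrite /Q (_ : _ - y = e *: (c - z) - (y - z)); last first.
      by apply/rowP => i; rewrite !mxE; ring.
    rewrite -(opprB y z); move: (c - z) (y - z) => b d.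
    by rewrite !(dotBl, dotBr, dotNl, dotNr, dotZl, dotZr) (dotC d b); ring.
  move=> zc.
  have {}zc : Q z <= Q z - 2 * e * dot (c - z) (y - z) +
      e * e * dot (c - z) (c - z).
    by apply: zc; apply: cC => //; rewrite (ltW e0).
  rewrite add0r -(ler_pM2l e0); have := mulr_ge0 (ltW e0) (ltW e0).
  have := mulr_ge0 (mulr_ge0 (ltW e0) (ltW e0)) (dot_ge0 (c - z)); lra.
have -> : c - y = (c - z) - (y - z) by apply/rowP => i; rewrite !mxE; ring.
by rewrite dotBl; lra.
Qed.

(** Otherwise the maximum of a linear form on S would be smaller than its value
    at p, and a closed half-space containing S would miss p. *)
Lemma compact_support_ge S p : compact S -> closure (convex_hull S) p ->
  forall v, exists2 q, S q & 0 <= dot (q - p) v.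
Proof.
move=> cS Sp v; apply: contrapT => nq.
have neg q : S q -> dot (q - p) v < 0.
  by move=> Sq; rewrite ltNge; apply/negP => qv; apply: nq; exists q.
have [S0|/set0P/negP/negPn/eqP S0] := pselect (S !=set0); last first.
  have /closure_normP cl := Sp; have [a Sa _] := cl 1 ltr01.
  have Sn : convex_hull S `<=` set0.
    by apply: convex_hull_min; [apply/convex_setP|rewrite S0].
  by have := Sn _ Sa.
have [m] := EVT_max_rV S0 cS (continuous_subspaceT (@continuous_dot _ _ v)).
rewrite inE => Sm mmax.
pose H := [set x | dot v x <= dot v m].
have clH : closed H.
  rewrite (_ : H = dot v @^-1` [set x | x <= dot v m])//.
  apply: preimage_closed; last exact: closed_le.
  by move=> x _; exact: continuous_dot.
have : closure (convex_hull S) `<=` H.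
  move: clH => /closure_id ->; apply: closureS; apply: convex_hull_min.
    apply/convex_setP => x y t Hx Hy /andP[t0 t1].
    rewrite /H /= dotDr !dotZr.
    have := ler_wpM2l t0 Hx; have := ler_wpM2l (_ : 0 <= 1 - t) Hy.
    rewrite subr_ge0 => /(_ t1); lra.
  by move=> q Sq; apply: mmax; rewrite inE.
move=> /(_ _ Sp); rewrite /H /=; have := neg _ Sm.
by rewrite dotBl !(dotC _ v); lra.
Qed.

(** In the perturbed direction theta + k w some point of S lies at least as
    far as p; let k tend to 0. *)
Lemma face_point S p theta : compact S -> closure (convex_hull S) p ->
  (forall q, S q -> dot (q - p) theta <= 0) ->
  forall w, exists q, [/\ S q, dot (q - p) theta = 0 & 0 <= dot (q - p) w].
Proof.
move=> cS Sp th w.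
pose P e := [set q |
  exists k, [/\ 0 < k, k <= e & 0 <= dot (q - p) (theta + k *: w)]].
have [||q Sq qP] := @compact_approx _ _ S P cS.
- by move=> e e' q ee' [k [k0 ke kq]]; exists k; split=> //; exact: le_trans ee'.
- move=> e e0; have [q Sq qk] := compact_support_ge cS Sp (theta + e *: w).
  by exists q => //; exists e.
have key e : 0 < e -> e <= 1 ->
    0 <= dot (q - p) w + e * (n%:R * `|w|) /\
    0 <= dot (q - p) theta +
      e * (n%:R * `|theta| + `|dot (q - p) w| + n%:R * `|w|).
  move=> e0 e1; have [q' [Sq' qq' [k [k0 ke]]]] := qP e e0.
  rewrite dotDr dotZr => H; have th' := th _ Sq'.
  have W0 : 0 <= dot (q' - p) w by rewrite -(pmulr_rge0 _ k0); lra.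
  have d u : `|dot (q' - p) u - dot (q - p) u| <= e * (n%:R * `|u|).
    rewrite -dotBl opprB addrA subrK.
    apply: le_trans (dot_le_norm _ _) _.
    by rewrite mulrCA ler_wpM2r ?mulr_ge0// ltW.
  have := d w; have := d theta; rewrite !ler_norml => /andP[_ dt] /andP[_ dw].
  split; first lra.
  have : k * dot (q' - p) w <= e * (`|dot (q - p) w| + n%:R * `|w|).
    apply: ler_pM; rewrite ?(ltW k0)//.
    have : e * (n%:R * `|w|) <= n%:R * `|w| by rewrite ler_piMl// mulr_ge0.
    by have := ler_norm (dot (q - p) w); lra.
  lra.
exists q; split=> //.
  apply/eqP; rewrite eq_le th//=.
  apply: (@le_of_small_error _ _
    (n%:R * `|theta| + `|dot (q - p) w| + n%:R * `|w|)).
    by rewrite !addr_ge0// mulr_ge0.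
  by move=> e e0 e1; have [] := key e e0 e1.
apply: (@le_of_small_error _ _ (n%:R * `|w|)); first by rewrite mulr_ge0.
by move=> e e0 e1; have [] := key e e0 e1.
Qed.

End ConvexSets.

Lemma convex_comb_witness (R : realType) (a b y : R) : a < b -> a <= y <= b ->
  exists2 t, 0 <= t <= 1 & t * a + (1 - t) * b = y.
Proof.
move=> ab /andP[ay yb]; have ba : 0 < b - a by rewrite subr_gt0.
exists ((b - y) / (b - a)); last by field; rewrite gt_eqF.
apply/andP; split; first by rewrite divr_ge0//; lra.
by rewrite ler_pdivrMr//; lra.
Qed.

(** Approximate the four corners of a square about p by points of C: joining
    the upper ones, then the lower ones, then the points so obtained
    on a vertical line, reaches every point near p. *)
Lemma interior_closure_convex (R : realType) (C : set 'rV[R]_2) :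
  convex_set C -> interior (closure C) `<=` interior C.
Proof.
move=> /convex_setP cC p /nbhs_ballP[r /= r0 rC].
pose s := r / 2; have s0 : 0 < s by rewrite divr_gt0.
have corner (a b : R) : `|a| <= s -> `|b| <= s -> exists c, [/\ C c,
    `|c 0 0 - (p 0 0 + a)| < s / 4 & `|c 0 1 - (p 0 1 + b)| < s / 4].
  move=> as_ bs.
  have /rC/closure_normP/(_ (s / 4)) : ball p r (p + point2 a b).
    apply/in_ball; rewrite addrC addKr.
    apply: (@le_lt_trans _ _ s); last by rewrite /s; lra.
    apply: norm_le_coord; first exact: ltW.
    by move=> i; have [->|->] := ord2P i; rewrite !mxE.
  move=> []; first by rewrite divr_gt0.
  move=> c Cc cs; exists c; split=> //; apply: le_lt_trans cs.
    by have := coord_le_norm (c - (p + point2 a b)) 0; rewrite !mxE.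
  by have := coord_le_norm (c - (p + point2 a b)) 1; rewrite !mxE.
have side (b y : R) : `|b| <= s -> `|y - p 0 0| < s / 2 -> exists c, [/\ C c,
    c 0 0 = y & `|c 0 1 - (p 0 1 + b)| < s / 4].
  move=> bs ys.
  have [||c1 [Cc1 x1 y1]] := corner (- s) b.
  - by rewrite normrN gtr0_norm.
  - by [].
  have [||c2 [Cc2 x2 y2]] := corner s b; first by rewrite gtr0_norm.
    by [].
  move: x1 x2 y1 y2 ys; rewrite !ltr_norml.
  move=> /andP[? ?] /andP[? ?] /andP[? ?] /andP[? ?] /andP[? ?].
  have [||t t01 tE] := @convex_comb_witness _ (c1 0 0) (c2 0 0) y; [lra|lra|].
  exists (t *: c1 + (1 - t) *: c2); split; first exact: cC.
    by rewrite !mxE.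
  rewrite !mxE ltr_norml; case/andP: t01 => t0 t1.
  have t1' : 0 <= 1 - t by rewrite subr_ge0.
  have t01 : 0 <= t <= 1 by rewrite t0.
  apply/andP; split; last first.
    by rewrite ltrBlDr; apply: convex_comb_lt => //; lra.
  rewrite ltrBrDr -ltrN2 opprD -!mulrN.
  by apply: convex_comb_lt => //; lra.
apply/nbhs_ballP; exists (s / 2); first by rewrite /= divr_gt0.
move=> x /in_ball xp.
have x0 := le_lt_trans (coord_le_norm (x - p) 0) xp.
have x1 := le_lt_trans (coord_le_norm (x - p) 1) xp.
move: x0 x1; rewrite !mxE => x0 x1.
have [|c1 [Cc1 h1 v1]] := side (- s) _ _ x0; first by rewrite normrN gtr0_norm.
have [|c2 [Cc2 h2 v2]] := side s _ _ x0; first by rewrite gtr0_norm.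
move: v1 v2 x1; rewrite !ltr_norml => /andP[? ?] /andP[? ?] /andP[? ?].
have [||t t01 tE] := @convex_comb_witness _ (c1 0 1) (c2 0 1) (x 0 1).
- by lra.
- by lra.
rewrite (_ : x = t *: c1 + (1 - t) *: c2); first exact: cC.
apply/rowP => i; have [->|->] := ord2P i; rewrite !mxE ?tE// h1 h2; ring.
Qed.

(** By [interior_closure_convex], p is a limit of points y outside the closure
    of the hull; separate each y from the hull and extract a limit of the
    normalized separating directions. *)
Lemma supporting_direction (R : realType) (S : set 'rV[R]_2) p :
  ~ interior (convex_hull S) p ->
  exists theta : 'rV[R]_2, theta != 0 /\ forall q, S q -> dot (q - p) theta <= 0.
Proof.
move=> nint.
have [[a Sa]|nS] := pselect (S !=set0); last first.
  exists (delta_mx 0 0); split; last by move=> q Sq; case: nS; exists q.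
  by apply/eqP => /rowP/(_ 0)/eqP; rewrite !mxE oner_eq0.
pose C := closure (convex_hull S).
have cC : convex_set C by apply/closure_convex/convex_hull_convex.
have SC : S `<=` C by move=> q /sub_convex_hull; exact: subset_closure.
pose K := [set v : 'rV[R]_2 | `|v| = 1].
pose P e := [set v : 'rV[R]_2 | forall q, S q -> dot (q - p) v <= 2 * e].
have cK : compact K.
  apply: bounded_closed_compact.
    exists 1; split; first exact: num_real.
    move=> M M1 v Kv; have v1 : `|v| <= 1 by rewrite (Kv : `|v| = 1).
    exact: le_trans v1 (ltW M1).
  rewrite (_ : K = (fun v : 'rV[R]_2 => `|v|) @^-1` [set x | x = 1])//.
  apply: preimage_closed; last exact: closed_eq.
  by move=> v _; exact: norm_continuous.
have [||theta Kt tP] := @compact_approx _ _ K P cK.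
- by move=> e e' v ee' Pv q /Pv/le_trans; apply; lra.
- move=> e e0.
  have [y yp nCy] : exists2 y, `|y - p| < e & ~ C y.
    apply: contrapT => H; apply: nint.
    apply: interior_closure_convex; first exact: convex_hull_convex.
    apply/nbhs_ballP; exists e => // y /in_ball yp.
    by apply: contrapT => nCy; apply: H; exists y.
  have Ca : C !=set0 by exists a; exact: SC.
  have [v [v0 vC]] := separate_point Ca (@closed_closure _ _) cC nCy.
  have nv : 0 < `|v| by rewrite normr_gt0.
  exists (`|v|^-1 *: v).
    by rewrite /K /= normrZ gtr0_norm ?invr_gt0// mulVf// gt_eqF.
  move=> q Sq; rewrite (_ : q - p = (q - y) + (y - p)); last first.
    by rewrite addrA subrK.
  rewrite dotDl !dotZr.
  have A1 : `|v|^-1 * dot (q - y) v <= 0.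
    by rewrite pmulr_rle0 ?invr_gt0// ltW// vC//; exact: SC.
  have A2 : `|v|^-1 * dot (y - p) v <= 2 * e.
    rewrite mulrC ler_pdivrMr//; apply: le_trans (ler_norm _) _.
    apply: le_trans (dot_le_norm _ _) _.
    by rewrite -mulrA ler_pM2l// ler_pM2r// ltW.
  lra.
exists theta; split; first by rewrite -normr_gt0 (Kt : `|theta| = 1).
move=> q Sq; apply: (@le_of_small_error _ _ _ (2 + 2 * `|q - p|)).
  by rewrite addr_ge0// mulr_ge0.
move=> e e0 e1; have [v [Kv vt /(_ q Sq) Pv]] := tP e e0.
have : dot (q - p) (theta - v) <= 2 * (`|q - p| * e).
  apply: le_trans (ler_norm _) _; apply: le_trans (dot_le_norm _ _) _.
  by rewrite ler_pM2l// ler_wpM2l// distrC ltW.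
rewrite dotBr; lra.
Qed.

(** * Sharp minima of a convex function across a direction *)

(** A convex function h of two real variables (t, s) near the origin, where
    D t s g1 g2 says that (g1, g2) is its gradient at (t, s). The hypotheses
    D_gap, D_limit and h_support describe a face of the subdifferential of h at
    the origin: it lies on the line g1 = 0, it stretches to distance e on both
    sides of g2 = 0, all limit gradients satisfy g1 <= 0, and none of them is
    close to 0. *)
Section Ridge.
Variables (R : realType) (h : R -> R -> R) (D : R -> R -> R -> R -> Prop).
Variables (rho L e : R).
Hypotheses (rho0 : 0 < rho) (L0 : 0 <= L) (e0 : 0 < e).

Definition in_box (t s : R) := `|t| < rho /\ `|s| < rho.

Hypothesis h_convex : forall t s t' s' k : R, in_box t s -> in_box t' s' ->
  0 <= k <= 1 ->
  h (k * t + (1 - k) * t') (k * s + (1 - k) * s') <=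
  k * h t s + (1 - k) * h t' s'.
Hypothesis h_lipschitz : forall t s t' s', in_box t s -> in_box t' s' ->
  `|h t s - h t' s'| <= L * (`|t - t'| + `|s - s'|).
Hypothesis D_subgradient : forall t s g1 g2 t' s', in_box t s ->
  in_box t' s' -> D t s g1 g2 ->
  h t s + (g1 * (t' - t) + g2 * (s' - s)) <= h t' s'.
Hypothesis D_bounded : forall t s g1 g2, in_box t s -> D t s g1 g2 ->
  `|g1| <= L /\ `|g2| <= L.
Hypothesis D_dense : forall t s eta : R, in_box t s -> 0 < eta ->
  exists t' s' g1 g2, [/\ `|t' - t| < eta, `|s' - s| < eta & D t' s' g1 g2].
Hypothesis D_gap : forall t s g1 g2, in_box t s -> D t s g1 g2 ->
  `|g1| < e -> e <= `|g2|.
Hypothesis D_limit : forall eta : R, 0 < eta -> exists2 r : R, 0 < r &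
  forall t s g1 g2 : R, `|t| < r -> `|s| < r -> D t s g1 g2 -> g1 <= eta.
Hypothesis h_support : forall t s, in_box t s -> h 0 0 + e * `|s| <= h t s.

Let constants_sign : [/\ 0 < rho, 0 <= L & 0 < e]. Proof. by []. Qed.

Lemma cone_in_box (delta t s : R) : delta < 1 -> 0 <= t -> t < rho ->
  `|s| <= delta * t -> in_box t s.
Proof.
move=> d1 t0 tr st; rewrite /in_box (ger0_norm t0); split=> //.
by apply: le_lt_trans st (le_lt_trans _ tr); rewrite ler_piMl// ltW.
Qed.

(** In a thin cone |s| <= delta t the first component g1 of a gradient is nearly
    0: it cannot be much larger by D_limit, nor much smaller since h does not
    decrease from the origin to (t, s). By D_gap the second component is then
    at least e in absolute value. The bound on h(t, 0) is the
    subgradient inequality at a gradient point close to (t, 0). *)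
Lemma vertical_gap_above_cone : exists delta r : R, [/\ 0 < delta, delta < 1,
  0 < r & r <= rho] /\
  (forall t s g1 g2 : R, 0 < t -> t < r -> `|s| <= delta * t -> D t s g1 g2 ->
     e <= `|g2|) /\
  (forall t : R, 0 < t -> t < r -> h t 0 <= h 0 0 + e * delta / 2 * t).
Proof.
have [? ? ?] := constants_sign.
pose delta := e / (L + e + 1).
have dn : 0 < L + e + 1 by lra.
have d0 : 0 < delta by rewrite divr_gt0.
have d1 : delta < 1 by rewrite ltr_pdivrMr//; lra.
have Ld : L * delta < e.
  by rewrite mulrA ltr_pdivrMr// mulrC ltr_pM2l//; lra.
have ed : 0 < e * delta by rewrite mulr_gt0.
have eds : e * delta < e by rewrite gtr_pMr.
have ed2 : 0 < e * delta / 2 by rewrite divr_gt0.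
have [r' r'0 Dr] := D_limit ed2.
pose r := Num.min r' rho.
have r0 : 0 < r by rewrite lt_min r'0.
have [rr' rrho] : r <= r' /\ r <= rho by rewrite !ge_min !lexx orbT.
have box0 : in_box 0 0 by rewrite /in_box normr0.
exists delta, r; split=> //; split.
  move=> t s g1 g2 t0 tr st Dts.
  have dt : delta * t < t by rewrite gtr_pMl.
  have tn : `|t| = t by rewrite gtr0_norm.
  have bts := cone_in_box d1 (ltW t0) (lt_le_trans tr rrho) st.
  apply: (D_gap bts Dts).
  have up : g1 <= e * delta / 2 by apply: (Dr t s g1 g2) => //; lra.
  have [_ g2L] := D_bounded bts Dts.
  have := D_subgradient bts box0 Dts; have := h_support bts.
  have := mulr_ge0 (ltW e0) (normr_ge0 s) => es H1 H2.
  have : `|g2 * s| <= L * (delta * t) by rewrite normrM ler_pM.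
  rewrite ler_norml => /andP[_ A].
  have : - (L * delta) * t <= g1 * t by lra.
  rewrite ler_pM2r// => B.
  by rewrite ltr_norml; apply/andP; split; lra.
move=> t t0 tr; apply/ler_addgt0Pr => eps eps0.
pose c := 2 * L + L + e * delta + 1.
have c0 : 0 < c by rewrite /c; lra.
have trho := lt_le_trans tr rrho.
have bt : in_box t 0 by rewrite /in_box normr0 gtr0_norm.
pose eta := Num.min (eps / c) (Num.min t (r - t)).
have rt : 0 < r - t by rewrite subr_gt0.
have eta0 : 0 < eta by rewrite !lt_min divr_gt0// t0.
have [e1 [e2 e3]] : eta <= eps / c /\ eta <= t /\ eta <= r - t.
  by rewrite !ge_min !lexx !orbT.
have [t' [s' [g1 [g2 [tt ss Dts]]]]] := D_dense bt eta0.
rewrite subr0 in ss.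
have [t'1 t'2] : 0 < t' /\ t' < r.
  by move: tt; rewrite ltr_norml => /andP[? ?]; split; lra.
have sr : `|s'| < r by apply: lt_le_trans ss (le_trans e3 _); rewrite gerBl ltW.
have tr' : `|t'| < r by rewrite gtr0_norm.
have bts : in_box t' s' by split; apply: lt_le_trans rrho.
have up : g1 <= e * delta / 2.
  by apply: (Dr t' s' g1 g2) => //; apply: lt_le_trans rr'.
have [_ g2L] := D_bounded bts Dts.
have H1 := D_subgradient bts box0 Dts.
have := h_lipschitz bt bts; rewrite sub0r normrN => /(le_trans (ler_norm _)) H2.
have H3 : g2 * s' <= L * eta.
  apply: le_trans (ler_norm _) _; rewrite normrM ler_pM// ltW//.
have H4 : L * (`|t - t'| + `|s'|) <= L * (2 * eta).
  by rewrite ler_wpM2l// (distrC t); lra.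
have H5 : g1 * t' <= e * delta / 2 * t'.
  by rewrite ler_pM2r.
have H6 : e * delta / 2 * t' <= e * delta / 2 * (t + eta).
  rewrite ler_pM2l ?divr_gt0//; move: tt; rewrite ltr_norml => /andP[? ?]; lra.
have H7 : eta * c <= eps by rewrite -ler_pdivlMr.
have H8 := mulr_ge0 (ltW ed) (ltW eta0).
rewrite /c in H7; lra.
Qed.

(** If h(t, .) grew slower than e/2 away from its minimum phi, then gradients
    near an interior point of the segment from phi to s1 would have a small
    vertical component. *)
Lemma sharp_minimum (delta r t phi : R) : 0 < delta -> delta < 1 -> r <= rho ->
  (forall t s g1 g2 : R, 0 < t -> t < r -> `|s| <= delta * t -> D t s g1 g2 ->
     e <= `|g2|) ->
  0 < t -> t < r -> `|phi| < delta * t ->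
  (forall s : R, `|s| <= delta * t -> h t phi <= h t s) ->
  forall s : R, `|s| <= delta * t -> h t phi + e / 2 * `|s - phi| <= h t s.
Proof.
have [? ? ?] := constants_sign.
move=> d0 d1 rrho gap t0 tr phit phimin s1 s1t.
have [->|neq] := eqVneq s1 phi; first by rewrite subrr normr0 mulr0 addr0.
rewrite leNgt; apply/negP => slow.
have k0 : 0 < `|s1 - phi| by rewrite normr_gt0 subr_eq0.
set k := s1 - phi in slow k0.
pose m := h t s1 - h t phi.
have m0 : 0 <= m by rewrite subr_ge0 phimin.
have ek0 : 0 < e * `|k| by rewrite mulr_gt0.
have mk : m < e / 2 * `|k| by rewrite /m; lra.
(* With this sg the average slope of h(t, .) from s to s1 is still below e/2. *)
pose sg := (e / 2 * `|k| - m) / (e * `|k|).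
have sg0 : 0 < sg by rewrite divr_gt0// subr_gt0.
have sg1 : sg <= 2^-1 by rewrite ler_pdivrMr//; lra.
have sgE : sg * (e * `|k|) = e / 2 * `|k| - m by rewrite divfK// gt_eqF.
clearbody sg.
pose s := phi + sg * k.
have dt : delta * t < t by rewrite gtr_pMl.
have tn : `|t| = t by rewrite gtr0_norm.
pose zeta := (1 - sg) * (delta * t - `|phi|).
have zeta0 : 0 < zeta by rewrite mulr_gt0// subr_gt0//; lra.
have sz : `|s| <= delta * t - zeta.
  rewrite (_ : s = (1 - sg) * phi + sg * s1); last by rewrite /s /k; ring.
  apply: le_trans (ler_normD _ _) _; rewrite (normrM (1 - sg)) (normrM sg).
  rewrite (gtr0_norm sg0) (@gtr0_norm _ (1 - sg)); last lra.
  have := ler_wpM2l (ltW sg0) s1t; rewrite /zeta; lra.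
clearbody zeta.
have L1 : 0 < 4 * (L + 1) by rewrite mulr_gt0// ltr_wpDl.
have q0 : 0 < e / 2 * (sg * `|k|).
  by apply: mulr_gt0; [rewrite divr_gt0|exact: mulr_gt0].
pose tau := Num.min (e / 2 * (sg * `|k|) / (4 * (L + 1)))
  (Num.min (zeta / 2) (Num.min t (r - t))).
have rt : 0 < r - t by rewrite subr_gt0.
have tau0 : 0 < tau by rewrite !lt_min !divr_gt0// t0.
have [u1 [u2 [u3 u4]]] : tau <= e / 2 * (sg * `|k|) / (4 * (L + 1)) /\
    tau <= zeta / 2 /\ tau <= t /\ tau <= r - t.
  by rewrite !ge_min !lexx !orbT.
have trho := lt_le_trans tr rrho.
have st : `|s| <= delta * t by apply: le_trans sz _; rewrite gerBl ltW.
have bs := cone_in_box d1 (ltW t0) trho st.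
have bphi := cone_in_box d1 (ltW t0) trho (ltW phit).
have bs1 := cone_in_box d1 (ltW t0) trho s1t.
have [t' [s' [g1 [g2 [tt ss Dts]]]]] := D_dense bs tau0.
have [t'1 t'2] : - tau < t' - t /\ t' - t < tau.
  by move: tt; rewrite ltr_norml => /andP.
have s't : `|s'| <= delta * t'.
  have : `|s'| <= `|s| + `|s' - s|.
    by apply: le_trans (ler_normD _ _); rewrite addrC subrK.
  have : delta * (t - tau) <= delta * t' by rewrite ler_pM2l//; lra.
  have : delta * tau <= tau by rewrite ger_pMl// ltW.
  lra.
have t'0 : 0 < t' by lra.
have t'r : t' < r by lra.
have bts := cone_in_box d1 (ltW t'0) (lt_le_trans t'r rrho) s't.
have g2e := gap t' s' g1 g2 t'0 t'r s't Dts.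
have [g1L g2L] := D_bounded bts Dts.
have Lt : 4 * (L * tau) < e / 2 * (sg * `|k|).
  have : tau * (4 * (L + 1)) <= e / 2 * (sg * `|k|) by rewrite -ler_pdivlMr.
  lra.
have near s2 : in_box t s2 ->
    h t s + g2 * (s2 - s) <= h t s2 + 4 * (L * tau).
  move=> b2; have := D_subgradient bts b2 Dts.
  have := h_lipschitz bs bts => /(le_trans (ler_norm _)).
  have : L * (`|t - t'| + `|s - s'|) <= L * (2 * tau).
    by rewrite ler_wpM2l// (distrC t) (distrC s); lra.
  have B g x : `|g| <= L -> `|x| < tau -> `|g * x| <= L * tau.
    by move=> gL xt; rewrite normrM ler_pM// ltW.
  have := B _ _ g1L tt; have := B _ _ g2L ss.
  rewrite !ler_norml => /andP[? ?] /andP[? ?]; lra.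
have := near _ bs1; have := near _ bphi.
have hs : h t phi <= h t s by exact: phimin.
rewrite (_ : phi - s = - (sg * k)); last by rewrite /s; ring.
rewrite (_ : s1 - s = (1 - sg) * k); last by rewrite /s /k; ring.
move=> lo hi.
have lo' : sg * - (e * `|k|) < sg * (g2 * k) by lra.
have hi' : (1 - sg) * (g2 * k) < (1 - sg) * (e * `|k|).
  have : sg * `|k| * e <= 2^-1 * `|k| * e by rewrite !ler_pM2r.
  rewrite /m in mk sgE; lra.
rewrite ltr_pM2l// in lo'; rewrite ltr_pM2l in hi'; last lra.
have : `|g2 * k| < e * `|k| by rewrite ltr_norml; apply/andP; split; lra.
by rewrite normrM ltr_pM2r// ltNge g2e.
Qed.

(** By h_support the values at the two ends of the segment |s| <= delta t exceed
    h(t, 0), so the minimum of h(t, .) is attained inside. *)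
Lemma ridge_exists : exists (delta alpha : R) (phi : R -> R),
  [/\ 0 < delta, delta < 1, 0 < alpha & alpha < rho] /\
  forall t : R, 0 <= t <= alpha -> `|phi t| <= delta * t /\
    (0 < t -> `|phi t| < delta * t) /\
    forall s : R, `|s| <= delta * t ->
      h t (phi t) + e / 2 * `|s - phi t| <= h t s.
Proof.
have [? ? ?] := constants_sign.
have [delta [r [[d0 d1 r0 rrho] [gap axis]]]] := vertical_gap_above_cone.
have alr : r / 2 < r by lra.
have : forall t : R, exists p : R, 0 <= t <= r / 2 -> `|p| <= delta * t /\
    (0 < t -> `|p| < delta * t) /\
    forall s : R, `|s| <= delta * t -> h t p + e / 2 * `|s - p| <= h t s.
  move=> t; have [/andP[]|nt] := boolP (0 <= t <= r / 2); last by exists 0.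
  rewrite le_eqVlt => /predU1P[<- _|t0 tr].
    exists 0 => _; rewrite mulr0 normr0 ltxx; split=> //; split=> // s.
    by rewrite normr_le0 => /eqP->; rewrite subr0 normr0 mulr0 addr0.
  have dt : delta * t < t by rewrite gtr_pMl.
  have dt0 : 0 < delta * t by rewrite mulr_gt0.
  have bt s : `|s| <= delta * t -> in_box t s.
    by apply: cone_in_box => //; [exact: ltW|lra].
  have hL (s s' : R) : `[- (delta * t), delta * t]%classic s ->
      `[- (delta * t), delta * t]%classic s' ->
      `|h t s - h t s'| <= L * `|s - s'|.
    rewrite /= !in_itv /= -!ler_norml => /bt bs /bt bs'.
    by have := h_lipschitz bs bs'; rewrite subrr normr0 add0r.
  have [|phi] := EVT_min _ (lipschitz_within_continuous hL); first lra.
  rewrite in_itv /= -ler_norml => phit phimin.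
  have {}phimin s : `|s| <= delta * t -> h t phi <= h t s.
    by move=> st; apply: phimin; rewrite in_itv /= -ler_norml.
  have strict : `|phi| < delta * t.
    rewrite lt_neqAle phit andbT; apply/eqP => phiE.
    have := h_support (bt _ phit); rewrite phiE.
    have := phimin 0; rewrite normr0 => /(_ (ltW dt0)).
    have := axis t t0; have := mulr_gt0 e0 dt0 => A B; have {}B := B (_ : t < r).
    by move=> C; have := B ltac:(lra); lra.
  exists phi => _; split=> //; split=> //.
  by apply: (sharp_minimum d0 d1 rrho gap) => //; lra.
move=> /choice[phi phiP]; exists delta, (r / 2), phi.
by split; [split=> //; lra|exact: phiP].
Qed.

(** The tilted functions h(t, s) + (e/2) s and h(t, s) - (e/2) s attain their
    minima over |s| <= delta t at the same point phi(t). The cone being convex,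
    both minima are convex functions of t, and their difference is e phi(t). *)
Lemma ridge_difference_of_convex (delta alpha : R) (phi : R -> R) :
  0 < delta -> delta < 1 -> alpha < rho ->
  (forall t : R, 0 <= t <= alpha -> `|phi t| <= delta * t /\
    forall s : R, `|s| <= delta * t ->
      h t (phi t) + e / 2 * `|s - phi t| <= h t s) ->
  forall c : R, `|c| <= e / 2 ->
  let F := fun t : R => (h t (phi t) + c * phi t) / e in
  convex_function `[0, alpha] F /\ [lipschitz F x | x in `[0, alpha]].
Proof.
have [? ? ?] := constants_sign.
move=> d0 d1 arho phiP c ce F.
have minF t s : 0 <= t <= alpha -> `|s| <= delta * t ->
    e * F t <= h t s + c * s.
  move=> ta st; have [_ /(_ _ st) H] := phiP t ta.
  rewrite /F mulrC divfK ?gt_eqF//.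
  have : `|c * (s - phi t)| <= e / 2 * `|s - phi t|.
    by rewrite normrM ler_wpM2r.
  rewrite ler_norml => /andP[A _]; lra.
have eF t : e * F t = h t (phi t) + c * phi t.
  by rewrite /F mulrC divfK ?gt_eqF.
clearbody F.
have bt t s : 0 <= t <= alpha -> `|s| <= delta * t -> in_box t s.
  move=> /andP[t0 ta]; apply: cone_in_box => //; exact: le_lt_trans arho.
split.
  apply/convex_functionP => t t' k; rewrite /= !in_itv /= => ta ta' /andP[k0 k1].
  have [pt _] := phiP t ta; have [pt' _] := phiP t' ta'.
  have k1' : 0 <= 1 - k by rewrite subr_ge0.
  move: (ta) (ta') => /andP[t0 t1] /andP[t'0 t'1].
  have ta'' : 0 <= k * t + (1 - k) * t' <= alpha.
    have := ler_wpM2l k0 t0; have := ler_wpM2l k0 t1.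
    have := ler_wpM2l k1' t'0; have := ler_wpM2l k1' t'1; rewrite !mulr0 => *.
    by apply/andP; split; lra.
  rewrite -(ler_pM2l e0) mulrDr !(mulrCA e) (eF t) (eF t').
  apply: le_trans (minF _ (k * phi t + (1 - k) * phi t') ta'' _) _.
    apply: le_trans (ler_normD _ _) _.
    rewrite !normrM (ger0_norm k0) (ger0_norm k1').
    have := ler_wpM2l k0 pt; have := ler_wpM2l k1' pt'; lra.
  have := h_convex (bt _ _ ta pt) (bt _ _ ta' pt').
  by move=> /(_ k); rewrite k0 k1 => /(_ isT); lra.
have half t t' : 0 <= t <= alpha -> 0 <= t' <= alpha ->
    e * F t' - e * F t <= (2 * L + e) * `|t' - t|.
  move=> ta ta'; have [pt _] := phiP t ta.
  move: (ta) (ta') => /andP[t0 t1] /andP[t'0 t'1].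
  have [s [st' ss]] : exists s, `|s| <= delta * t' /\ `|s - phi t| <= `|t' - t|.
    move: t0; rewrite le_eqVlt => /predU1P[t0|t0].
      exists 0; rewrite normr0 mulr_ge0//; last exact: ltW.
      by move: pt; rewrite -t0 mulr0 normr_le0 => /eqP->; rewrite subr0 normr0.
    (* the point of the cone above t' on the ray through (t, phi t) *)
    exists (phi t / t * t').
    have q : `|phi t / t| <= delta.
      by rewrite normrM normfV (gtr0_norm t0) ler_pdivrMr.
    rewrite (normrM (phi t / t)) (ger0_norm t'0) ler_wpM2r//; split=> //.
    rewrite (_ : _ - phi t = phi t / t * (t' - t)).
      by rewrite (normrM (phi t / t)) ler_piMl//; lra.
    by field; rewrite gt_eqF.
  have := minF t' s ta' st'; rewrite (eF t).
  have := h_lipschitz (bt _ _ ta' st') (bt _ _ ta pt).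
  move=> /(le_trans (ler_norm _)).
  have : L * (`|t' - t| + `|s - phi t|) <= L * (2 * `|t' - t|).
    by rewrite ler_wpM2l//; lra.
  have : `|c * (s - phi t)| <= e * `|t' - t|.
    rewrite normrM ler_pM//; lra.
  rewrite ler_norml => /andP[_ ?]; lra.
exists ((2 * L + e) / e); split; first exact: num_real.
move=> M /ltW; rewrite ler_pdivrMr// (mulrC M) => LM [t t'] /=.
rewrite !in_itv /= => -[ta ta'].
have lip x y : 0 <= x <= alpha -> 0 <= y <= alpha -> F y - F x <= M * `|y - x|.
  move=> xa ya; rewrite -(ler_pM2l e0) mulrBr; apply: le_trans (half x y xa ya) _.
  by rewrite mulrA; exact: ler_wpM2r.
suff : `|F t - F t'| <= M * `|t - t'| by [].
rewrite ler_norml; have := lip _ _ ta ta'; have := lip _ _ ta' ta.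
by rewrite (distrC t'); lra.
Qed.

End Ridge.

(** * Reachable gradients of semiconcave functions *)

Section LimitGradients.
Variables (R : realType) (n : nat).
Implicit Types (f u : 'rV[R]_n -> R) (c p q x G : 'rV[R]_n).

Lemma closed_limgrad f c : closed (limgrad f c).
Proof.
move=> q /closure_normP clq e e0.
have e2 : 0 < e / 2 by rewrite divr_gt0.
have [q' /(_ _ e2)[x [G [xc fG Gq']]] q'q] := clq _ e2.
exists x, G; split=> //; first by apply: lt_trans xc _; lra.
rewrite -(subrKA q'); apply: le_lt_trans (ler_normD _ _) _; lra.
Qed.

Lemma reachable_gradientsE (Omega : set 'rV[R]_n) u c : open Omega -> Omega c ->
  reachable_gradients Omega u c = limgrad u c.
Proof.
move=> oO Oc; rewrite predeqE => p; split.
  move=> [x_ [Ox xc Gp]] e e0.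
  have [i [xi Gi]] : exists i, `|c - x_ i| < e /\ `|p - grad u (x_ i)| < e.
    apply: (@filter_ex _ \oo); apply: filterI.
      exact: (cvgrPdist_lt _ _).1 xc _ e0.
    exact: (cvgrPdist_lt _ _).1 Gp _ e0.
  have [Oi di] := Ox i.
  exists (x_ i), (grad u (x_ i)); rewrite distrC; split=> //.
    by apply/isgradP.
  by rewrite distrC.
move=> up; have /nbhs_ballP[r /= r0 rO] : nbhs c Omega by exact: open_nbhs_nbhs.
have : forall i : nat, exists x, [/\ Omega x /\ differentiable u x,
    `|x - c| < i.+1%:R^-1 & `|grad u x - p| < i.+1%:R^-1].
  move=> i; have i0 : 0 < Num.min r i.+1%:R^-1 by rewrite lt_min r0 invr_gt0 ltr0n.
  have [x [G [xc uG Gp]]] := up _ i0.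
  move: xc Gp; rewrite !lt_min => /andP[xr xi] /andP[_ Gi].
  move/isgradP : uG => [du GE]; exists x; rewrite GE; split=> //.
  by split=> //; apply/rO/in_ball.
move=> /choice[x_ xP]; exists x_; split.
- by move=> i; have [] := xP i.
- apply/cvgrPdist_lt => _/posnumP[e]; near=> i; rewrite distrC.
  have [_ xi _] := xP i; apply: lt_trans xi _.
  by near: i; exact: near_infty_natSinv_lt.
- apply/cvgrPdist_lt => _/posnumP[e]; near=> i; rewrite distrC.
  have [_ _ xi] := xP i; apply: lt_trans xi _.
  by near: i; exact: near_infty_natSinv_lt.
Unshelve. all: by end_near. Qed.

(** If u is semiconcave with constant K then this function is convex near c; the
    linear term moves p, as a possible gradient of u at c, to 0. *)
Definition convexify p (K : R) c u : 'rV[R]_n -> R :=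
  fun x => dot p (x - c) - u x + K * dot (x - c) (x - c).

(** An involution: so every fact on gradients need only be transferred in one
    direction. *)
Lemma convexifyK p K c u : convexify p K c (convexify p K c u) = u.
Proof. by apply/funext => x; rewrite /convexify; ring. Qed.

Lemma isgrad_convexify p K c u x G : isgrad u x G ->
  isgrad (convexify p K c u) x (p - G + (2 * K) *: (x - c)).
Proof.
move=> uG e e0; have e2 : 0 < e / 2 by rewrite divr_gt0.
have [d d0 H] := uG _ e2.
have kn : 0 < 2 * (`|K| * n%:R + 1) by rewrite mulr_gt0// ltr_wpDl// mulr_ge0.
exists (Num.min d (e / (2 * (`|K| * n%:R + 1)))).
  by rewrite lt_min d0 divr_gt0.
move=> h; rewrite lt_min => /andP[hd he].
have -> : convexify p K c u (x + h) - convexify p K c u x -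
    dot (p - G + (2 * K) *: (x - c)) h =
    K * dot h h - (u (x + h) - u x - dot G h).
  rewrite /convexify -(addrA x) (addrC h) addrA; move: (x - c) => a.
  rewrite !(dotDr, dotDl, dotNl, dotZl) (dotC h a); ring.
apply: le_trans (ler_normB _ _) _.
have := H _ hd.
have : `|K * dot h h| <= e / 2 * `|h|.
  rewrite normrM; apply: le_trans (ler_wpM2l (normr_ge0 K) (dot_le_norm h h)) _.
  rewrite !mulrA ler_wpM2r//; move: he; rewrite ltr_pdivlMr// => he.
  by have := normr_ge0 h; lra.
lra.
Qed.

Lemma limgrad_convexify p K c u q :
  limgrad u c q -> limgrad (convexify p K c u) c (p - q).
Proof.
move=> uq e e0.
have k0 : 0 < 2 * `|K| + 1 by rewrite ltr_wpDl// mulr_ge0.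
have m0 : 0 < Num.min e (e / 2 / (2 * `|K| + 1)).
  by rewrite lt_min e0 !divr_gt0.
have m2 : 0 < Num.min (e / 2) (Num.min e (e / 2 / (2 * `|K| + 1))).
  by rewrite lt_min m0 divr_gt0.
have [x [G [xc uG Gq]]] := uq _ m2.
move: xc Gq; rewrite !lt_min => /and3P[_ xe xk] /and3P[Gq _ _].
exists x, (p - G + (2 * K) *: (x - c)); split=> //; first exact: isgrad_convexify.
rewrite (_ : _ - (p - q) = (q - G) + (2 * K) *: (x - c)); last first.
  by apply/rowP => i; rewrite !mxE; ring.
apply: le_lt_trans (ler_normD _ _) _; rewrite normrZ normrM gtr0_norm//.
rewrite distrC; move: xk; rewrite ltr_pdivlMr// => xk.
by have := normr_ge0 (x - c); lra.
Qed.

Lemma limgrad_norm_ge f c g (e : R) : limgrad f c g ->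
  (forall x G, `|x - c| < e -> isgrad f x G -> e <= `|G|) -> e <= `|g|.
Proof.
move=> fg gap; rewrite leNgt; apply/negP => ge.
have e0 : 0 < e by apply: le_lt_trans ge.
have m0 : 0 < Num.min e (e - `|g|) by rewrite lt_min e0 subr_gt0.
have [x [G [xc fG Gg]]] := fg _ m0.
move: xc Gg; rewrite !lt_min => /andP[xc _] /andP[_ Gg].
have := gap x G xc fG; rewrite -(subrK g G).
move=> /le_trans/(_ (ler_normD _ _)); lra.
Qed.

Lemma limgrad_subgradient f c (r L : R) g y : 0 < r -> 0 <= L ->
  convex_function (ball c r) f ->
  (forall x x', ball c r x -> ball c r x' -> `|f x - f x'| <= L * `|x - x'|) ->
  (forall x G, ball c r x -> isgrad f x G -> forall v, `|dot G v| <= L * `|v|) ->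
  limgrad f c g -> ball c r y -> f c + dot g (y - c) <= f y.
Proof.
move=> r0 L0 cf fL GL fg yb.
apply: (@le_of_small_error _ _ _ (2 * L + n%:R * `|y - c|)).
  by rewrite addr_ge0// mulr_ge0.
move=> e e0 e1.
have m0 : 0 < Num.min e r by rewrite lt_min e0.
have [x [G [xc fG Gg]]] := fg _ m0.
move: xc Gg; rewrite !lt_min => /andP[xe xr] /andP[Ge _].
have xb : ball c r x by apply/in_ball.
have cb : ball c r c by exact: ballxx.
have A1 := convex_subgradient cf xb yb fG.
have A2 := le_trans (ler_norm _) (fL _ _ cb xb).
have A3 := le_trans (ler_norm _) (GL _ _ xb fG (x - c)).
have A4 := le_trans (ler_norm _) (dot_le_norm (g - G) (y - c)).
have A5 : L * `|x - c| <= L * e by rewrite ler_wpM2l// ltW.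
have A6 : `|g - G| * `|y - c| <= e * `|y - c|.
  by rewrite ler_wpM2r// distrC ltW.
have A7 := ler_wpM2l (ler0n R n) A6.
have A8 : dot g (y - c) = dot G (y - x) + dot G (x - c) + dot (g - G) (y - c).
  by rewrite !(dotBl, dotBr); ring.
rewrite distrC in A2; lra.
Qed.

End LimitGradients.

(** * Orthonormal frames of the plane *)

Section Frame.
Variable R : realType.
Implicit Types (v w theta : 'rV[R]_2).

Definition perp v : 'rV[R]_2 := point2 (- v 0 1) (v 0 0).

Lemma dotE2 v w : dot v w = v 0 0 * w 0 0 + v 0 1 * w 0 1.
Proof.
have -> : (1 : 'I_2) = lift ord0 ord0 by exact: val_inj.
by rewrite /dot !big_ord_recl big_ord0 addr0.
Qed.

Lemma dot_perp v : dot v (perp v) = 0.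
Proof. by rewrite dotE2 !mxE /=; ring. Qed.

Lemma dot_perp_perp v w : dot (perp v) (perp w) = dot v w.
Proof. by rewrite !dotE2 !mxE /=; ring. Qed.

Lemma frame_decomposition theta v : dot theta theta = 1 ->
  v = dot v theta *: theta + dot v (perp theta) *: perp theta.
Proof.
rewrite !dotE2 => th; apply/rowP => i.
have [->|->] := ord2P i; rewrite !mxE /=.
  by rewrite -[LHS]mulr1 -th; ring.
by rewrite -[LHS]mulr1 -th; ring.
Qed.

Lemma norm_unit_le1 theta : dot theta theta = 1 -> `|theta| <= 1.
Proof.
move=> th; have := norm_sqr_le_dot theta; rewrite th => H.
by rewrite -(ler_sqr (normr_ge0 _) ler01) expr1n.
Qed.

End Frame.

(** * Singular arcs *)

(** In the orthonormal frame (theta, perp theta) at c, theta is an outer normal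
    of the subdifferential of f at c at the vector 0. This vector lies on the
    face cut out by theta, between the limit gradients g1 and g2, but is not a
    limit gradient itself. In these coordinates f satisfies the hypotheses of the part on
    sharp minima. *)
Lemma convex_singular_ridge (R : realType) (f : 'rV[R]_2 -> R) c
    (r L e : R) theta g1 g2 :
  0 < r -> 0 <= L -> 0 < e ->
  convex_function (ball c r) f ->
  (forall x y, ball c r x -> ball c r y -> `|f x - f y| <= L * `|x - y|) ->
  (forall x G, ball c r x -> isgrad f x G -> forall v, `|dot G v| <= L * `|v|) ->
  dot theta theta = 1 ->
  (forall x G, `|x - c| < e -> isgrad f x G -> e <= `|G|) ->
  (forall q, limgrad f c q -> dot q theta <= 0) ->
  limgrad f c g1 -> dot g1 theta = 0 -> 0 <= dot g1 (perp theta) ->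
  limgrad f c g2 -> dot g2 theta = 0 -> dot g2 (perp theta) <= 0 ->
  exists (alpha : R) (y1 y2 : R -> R),
    [/\ 0 < alpha, y1 0 - y2 0 = 0,
        convex_function `[0, alpha] y1 /\ [lipschitz y1 x | x in `[0, alpha]],
        convex_function `[0, alpha] y2 /\ [lipschitz y2 x | x in `[0, alpha]]
      & forall t : R, 0 < t -> t <= alpha ->
        let x := c + (t *: theta + (y1 t - y2 t) *: perp theta) in
        ball c r x /\ forall G, ~ isgrad f x G].
Proof.
move=> r0 L0 e0 cf fL GL th1 gap Eth Eg1 g1th g1p Eg2 g2th g2p.
set eta := perp theta.
have ep1 : dot eta eta = 1 by rewrite dot_perp_perp.
have nth := norm_unit_le1 th1; have nep := norm_unit_le1 ep1.
pose X t s := c + (t *: theta + s *: eta).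
have XB t s t' s' : X t s - X t' s' = (t - t') *: theta + (s - s') *: eta.
  by apply/rowP => i; rewrite !mxE; ring.
have XcE t s : X t s - c = t *: theta + s *: eta by rewrite addrC addKr.
have normX (a b : R) : `|a *: theta + b *: eta| <= `|a| + `|b|.
  by apply: le_trans (ler_normD _ _) _; rewrite !normrZ lerD// ler_piMr.
have normG G : `|G| <= `|dot G theta| + `|dot G eta|.
  by rewrite {1}(frame_decomposition G th1).
(* A gradient of norm at least e has one coordinate of size at least e / 2. *)
pose e' := e / 2; have e'0 : 0 < e' by rewrite divr_gt0.
pose rho := Num.min r e / 2.
have m0 : 0 < Num.min r e by rewrite lt_min r0.
have rho0 : 0 < rho by rewrite divr_gt0.
have boxE t s : in_box rho t s -> `|X t s - c| < Num.min r e.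
  move=> [tr sr]; rewrite XcE; apply: le_lt_trans (normX _ _) _.
  by rewrite /rho in tr sr; lra.
have boxr t s : in_box rho t s -> ball c r (X t s).
  by move=> /boxE; rewrite lt_min => /andP[? _]; apply/in_ball.
have boxe t s : in_box rho t s -> `|X t s - c| < e.
  by move=> /boxE; rewrite lt_min => /andP[].
pose h t s := f (X t s).
pose D t s a b :=
  exists G, [/\ isgrad f (X t s) G, a = dot G theta & b = dot G eta].
have h_convex t s t' s' k : in_box rho t s -> in_box rho t' s' -> 0 <= k <= 1 ->
    h (k * t + (1 - k) * t') (k * s + (1 - k) * s') <=
    k * h t s + (1 - k) * h t' s'.
  move=> /boxr bx /boxr by' k01; rewrite /h.
  rewrite (_ : X (k * t + _) _ = k *: X t s + (1 - k) *: X t' s').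
    by move/convex_functionP : cf; apply.
  by apply/rowP => i; rewrite !mxE; ring.
have h_lip t s t' s' : in_box rho t s -> in_box rho t' s' ->
    `|h t s - h t' s'| <= L * (`|t - t'| + `|s - s'|).
  move=> /boxr bx /boxr by'; apply: le_trans (fL _ _ bx by') _.
  by rewrite ler_wpM2l// XB normX.
have D_sub t s a b t' s' : in_box rho t s -> in_box rho t' s' -> D t s a b ->
    h t s + (a * (t' - t) + b * (s' - s)) <= h t' s'.
  move=> /boxr bx /boxr by' [G [fG -> ->]].
  have := convex_subgradient cf bx by' fG.
  by rewrite XB dotDr !dotZr (mulrC (t' - t)) (mulrC (s' - s)).
have D_bnd t s a b : in_box rho t s -> D t s a b -> `|a| <= L /\ `|b| <= L.
  move=> /boxr bx [G [fG -> ->]].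
  by split; apply: le_trans (GL _ _ bx fG _) _; rewrite ler_piMr.
have D_dns t s z : in_box rho t s -> 0 < z -> exists t' s' a b,
    [/\ `|t' - t| < z, `|s' - s| < z & D t' s' a b].
  move=> /boxr bx z0; have z2 : 0 < z / 2 by rewrite divr_gt0.
  have [x [G [xX fG]]] := convex_gradient_dense L0 cf fL bx z2.
  have [t' [s' xE]] : exists t' s', x = X t' s'.
    exists (dot (x - c) theta), (dot (x - c) eta).
    by rewrite /X -(frame_decomposition _ th1) addrC subrK.
  have co (v : 'rV[R]_2) : `|v| <= 1 -> `|dot (x - X t s) v| < z.
    move=> v1; apply: le_lt_trans (dot_le_norm _ _) _.
    have : `|x - X t s| * `|v| <= `|x - X t s| by rewrite ler_piMr.
    lra.
  exists t', s', (dot G theta), (dot G eta).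
  split; last by exists G; rewrite -xE.
    have := co theta nth; rewrite xE XB dotDl !dotZl th1.
    by rewrite (dotC eta) dot_perp mulr0 addr0 mulr1.
  have := co eta nep; rewrite xE XB dotDl !dotZl ep1.
  by rewrite dot_perp mulr0 add0r mulr1.
have D_gp t s a b : in_box rho t s -> D t s a b -> `|a| < e' -> e' <= `|b|.
  move=> /boxe bx [G [fG -> ->]] ae; have := gap _ _ bx fG; have := normG G.
  by rewrite /e' in ae *; lra.
have D_lim z : 0 < z -> exists2 r', 0 < r' &
    forall t s a b, `|t| < r' -> `|s| < r' -> D t s a b -> a <= z.
  move=> z0; apply: contrapT => nr.
  (* Gradients G at points tending to c with dot G theta >= z would accumulate
     at a limit gradient violating Eth. *)
  pose K := [set v : 'rV[R]_2 | `|v| <= L /\ z <= dot v theta].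
  pose P d := [set G : 'rV[R]_2 | exists2 x, `|x - c| < d & isgrad f x G].
  have cK : compact K.
    rewrite (_ : K = [set v | `|v - 0| <= L] `&` dot theta @^-1` [set x | z <= x]).
      apply: compact_closedI; first exact: compact_closed_ball.
      apply: preimage_closed; last exact: closed_ge.
      by move=> v _; exact: continuous_dot.
    by apply/seteqP; split=> v; rewrite /K /= subr0 dotC.
  have [||q [_ zq] qP] := @compact_approx _ _ K P cK.
  - by move=> d d' v dd' [x xd fx]; exists x => //; exact: lt_le_trans dd'.
  - move=> d d0; have m1 : 0 < Num.min d rho by rewrite lt_min d0.
    apply: contrapT => nq; apply: nr; exists (Num.min d rho / 2).
      by rewrite divr_gt0.
    move=> t s a b tr sr [G [fG aE _]]; rewrite leNgt; apply/negP => za.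
    have Xm : `|X t s - c| < Num.min d rho.
      by rewrite XcE; apply: le_lt_trans (normX _ _) _; lra.
    move: Xm tr sr; rewrite lt_min => /andP[Xd Xr] tr sr.
    apply: nq; exists G; last by exists (X t s).
    split; last by rewrite -aE ltW.
    have bx : ball c r (X t s).
      apply/in_ball; apply: lt_trans Xr _.
      have : Num.min r e <= r by rewrite ge_min lexx.
      by rewrite /rho; lra.
    exact: norm_le_dual (GL _ _ bx fG).
  have : limgrad f c q.
    by move=> d d0; have [G [_ Gq [x xd fx]]] := qP d d0; exists x, G.
  by move=> /Eth; lra.
have X00 : X 0 0 = c by rewrite /X !scale0r !addr0.
have h_sup t s : in_box rho t s -> h 0 0 + e' * `|s| <= h t s.
  move=> bx; rewrite /h X00.
  have sub g : limgrad f c g -> dot g theta = 0 ->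
      f c + s * dot g eta <= f (X t s).
    move=> Eg gth; have := limgrad_subgradient r0 L0 cf fL GL Eg (boxr _ _ bx).
    by rewrite XcE dotDr !dotZr gth mulr0 add0r.
  have big g : limgrad f c g -> dot g theta = 0 -> e <= `|dot g eta|.
    move=> Eg gth; have := limgrad_norm_ge Eg gap.
    move=> /le_trans; apply; apply: le_trans (normG g) _.
    by rewrite gth normr0 add0r.
  have [s0|s0] := leP 0 s.
    have := sub _ Eg1 g1th; have := big _ Eg1 g1th.
    rewrite (ger0_norm s0) (ger0_norm g1p) => A.
    have := ler_wpM2l s0 A; have := mulr_ge0 (ltW e0) s0; rewrite /e'; lra.
  have := sub _ Eg2 g2th; have := big _ Eg2 g2th.
  rewrite (ltr0_norm s0) (ler0_norm g2p) => A.
  have s0' : 0 <= - s by lra.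
  have := ler_wpM2l s0' A; have := mulr_ge0 (ltW e0) s0'; rewrite /e'; lra.
have [delta [alpha [phi [[d0 d1 a0 arho] phiP]]]] :=
  ridge_exists rho0 L0 e'0 h_lip D_sub D_bnd D_dns D_gp D_lim h_sup.
have phiP' t : 0 <= t <= alpha -> `|phi t| <= delta * t /\
    forall s, `|s| <= delta * t -> h t (phi t) + e' / 2 * `|s - phi t| <= h t s.
  by move=> /phiP[? [_ ?]].
have dc := ridge_difference_of_convex rho0 L0 e'0 h_convex h_lip d0 d1 arho phiP'.
pose y k t := (h t (phi t) + k * phi t) / e'.
have yE t : y (e' / 2) t - y (- (e' / 2)) t = phi t.
  by rewrite /y; field; rewrite gt_eqF.
exists alpha, (y (e' / 2)), (y (- (e' / 2))); split=> //.
- rewrite yE; have z0 : 0 <= (0 : R) <= alpha by apply/andP; split; [|exact: ltW].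
  by have [+ _] := phiP' 0 z0; rewrite mulr0 normr_le0 => /eqP.
- by apply: dc; rewrite gtr0_norm// divr_gt0.
- by apply: dc; rewrite normrN gtr0_norm// divr_gt0.
move=> t t0 ta /=; rewrite yE -/eta -/(X t (phi t)).
have ta' : 0 <= t <= alpha by rewrite (ltW t0).
have [_ [/(_ t0) strict sharp]] := phiP t ta'.
have dt : delta * t < t by rewrite gtr_pMl.
split; first by apply: boxr; rewrite /in_box gtr0_norm//; split; lra.
move=> G fG; have e4 : 0 < e' / 4 by rewrite divr_gt0.
have [d dpos H] := fG _ e4.
have m1 : 0 < Num.min d (delta * t - `|phi t|) by rewrite lt_min dpos subr_gt0.
pose k := Num.min d (delta * t - `|phi t|) / 2.
have k0 : 0 < k by rewrite divr_gt0.
have : k < Num.min d (delta * t - `|phi t|) by rewrite /k; lra.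
rewrite lt_min => /andP[kd kp].
(* The sharp minimum of f in the direction eta prevents a gradient. *)
have step (s : R) : `|s| = k -> e' / 4 * k <= s * dot G eta.
  move=> sk; have se : `|s *: eta| <= k by rewrite normrZ sk ler_piMr// ltW.
  have := H _ (le_lt_trans se kd).
  rewrite (_ : X t (phi t) + s *: eta = X t (phi t + s)); last first.
    by apply/rowP => i; rewrite !mxE; ring.
  rewrite dotZr => /(le_trans (ler_norm _)).
  have : e' / 4 * `|s *: eta| <= e' / 4 * k by rewrite ler_pM2l.
  have := sharp (phi t + s); rewrite (addrC (phi t)) addrK sk => A B C.
  have : h t (phi t) + e' / 2 * k <= h t (s + phi t).
    by apply: A; apply: le_trans (ler_normD _ _) _; lra.
  rewrite /h (addrC s) in C *; lra.
have := step k (gtr0_norm k0).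
have := step (- k); rewrite normrN => /(_ (gtr0_norm k0)).
by have := mulr_gt0 e4 k0; lra.
Qed.

Lemma enorm_lt (R : realType) (v : 'rV[R]_2) (r : R) :
  `|v| < r / 2 -> enorm v < r.
Proof.
move=> vr; have r0 : 0 < r by have := normr_ge0 v; lra.
rewrite -(@ltr_sqr _ (enorm v) r) ?nnegrE ?sqrtr_ge0 ?ltW// enorm_sqr.
apply: le_lt_trans (le_trans (ler_norm _) (dot_le_norm _ _)) _.
have : `|v| * `|v| <= r / 2 * (r / 2) by rewrite ler_pM// ltW.
have := mulr_gt0 r0 r0; rewrite expr2; lra.
Qed.

(** The Euclidean paraboloids about 0 and about c with the same constant differ
    by an affine function. *)
Lemma semiconcave_convexify (R : realType) (Omega : set 'rV[R]_2)
    (u : 'rV[R]_2 -> R) c p : semiconcave Omega u -> Omega c ->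
  exists r K, [/\ 0 < r, ball c r `<=` Omega
    & convex_function (ball c r) (convexify p K c u)].
Proof.
move=> scu /scu[r [K [g [r0 rO /convex_functionP cg uE]]]].
have sub : ball c (r / 2) `<=` eball c r by move=> x /in_ball; exact: enorm_lt.
exists (r / 2), K; split; first by rewrite divr_gt0.
  by move=> x /sub/rO.
apply/convex_functionP => x y t bx by' t01.
have bz : ball c (r / 2) (t *: x + (1 - t) *: y).
  exact: ball_convex.
have := cg x y t (sub _ bx) (sub _ by') t01.
rewrite /convexify (uE _ (sub _ bx)) (uE _ (sub _ by')) (uE _ (sub _ bz)).
rewrite !enorm_sqr.
move: (g _) (g x) (g y) => gz gx gy.
rewrite !(dotBl, dotBr, dotDl, dotDr, dotZl, dotZr, dotNl, dotNr).
by rewrite (dotC y x) (dotC c x) (dotC c y); lra.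
Qed.

Lemma convex_lipschitz_ball (R : realType) (f : 'rV[R]_2 -> R) c (r : R) :
  0 < r -> convex_function (ball c r) f ->
  exists rho L, [/\ 0 < rho, rho <= r, 0 <= L,
    forall x y, ball c rho x -> ball c rho y -> `|f x - f y| <= L * `|x - y|
  & forall x G, ball c rho x -> isgrad f x G ->
      forall v, `|dot G v| <= L * `|v| ].
Proof.
move=> r0 cf; have [M fM] := convex_locally_bounded r0 cf.
pose rho := r / 8; have rho0 : 0 < rho by rewrite divr_gt0.
have rhoE : 2 * rho = r / 4 by rewrite /rho; field.
have M0 : 0 <= M.
  by apply: le_trans (fM c _) => //; apply: ballxx; rewrite divr_gt0.
have L0 : 0 <= 2 * M / rho by rewrite divr_ge0 ?mulr_ge0// ltW.
have fL : forall x y, ball c rho x -> ball c rho y ->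
    `|f x - f y| <= 2 * M / rho * `|x - y|.
  apply: convex_bounded_lipschitz => //; rewrite rhoE//.
  move=> t x y xb yb; apply: cf; rewrite inE.
    by move: xb; rewrite inE; apply: le_ball; lra.
  by move: yb; rewrite inE; apply: le_ball; lra.
exists rho, (2 * M / rho); split=> //; first by rewrite /rho; lra.
move=> x G xb fG; have /in_ball xc := xb.
have d0 : 0 < rho - `|x - c| by rewrite subr_gt0.
apply: (isgrad_norm_le d0 L0 _ fG) => h hd.
have xh : x + h - x = h by rewrite addrC addKr.
have := fL (x + h) x; rewrite xh; apply=> //.
apply/in_ball; rewrite addrAC; apply: le_lt_trans (ler_normD _ _) _.
by rewrite -ltrBrDl.
Qed.

Lemma compact_limgrad (R : realType) (n : nat) (f : 'rV[R]_n -> R) c (r L : R) :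
  0 < r -> (forall x G, ball c r x -> isgrad f x G -> `|G| <= L) ->
  compact (limgrad f c).
Proof.
move=> r0 GL; apply: bounded_closed_compact; last exact: closed_limgrad.
exists L; split; first exact: num_real.
move=> M LM q fq; have m0 : 0 < Num.min r (M - L) by rewrite lt_min r0 subr_gt0.
have [x [G [xc fG Gq]]] := fq _ m0.
move: xc Gq; rewrite !lt_min => /andP[xr _] /andP[_ Gq].
have GL' := GL _ _ ((in_ball _ _ _).2 xr) fG.
have := ler_normD (q - G) G; rewrite subrK (distrC q) => /le_trans; apply.
by lra.
Qed.

Lemma enorm_eq (R : realType) (n : nat) (v w : 'rV[R]_n) :
  dot v v = dot w w -> enorm v = enorm w.
Proof.
rewrite -!enorm_sqr => /eqP; rewrite eqrXn2 ?sqrtr_ge0// => /eqP //.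
Qed.

Lemma dot_frame (R : realType) (theta v : 'rV[R]_2) : dot theta theta = 1 ->
  dot v v = dot v theta * dot v theta + dot v (perp theta) * dot v (perp theta).
Proof.
by move=> th1; rewrite {2}(frame_decomposition v th1) dotDr !dotZr.
Qed.

Lemma frame_coordinates (R : realType) (c theta : 'rV[R]_2) :
  dot theta theta = 1 ->
  cartesian_coordinates
    (fun x => point2 (dot (x - c) theta) (dot (x - c) (perp theta))).
Proof.
move=> th1.
have ep1 : dot (perp theta) (perp theta) = 1 by rewrite dot_perp_perp.
split.
  exists (fun v : 'rV[R]_2 => c + (v 0 0 *: theta + v 0 1 *: perp theta)).
    move=> x; rewrite !mxE /= -(frame_decomposition _ th1) addrC subrK //.
  move=> v; rewrite addrC addKr !dotDl !dotZl th1 ep1 (dotC (perp theta)) dot_perp.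
  apply/rowP => i; have [->|->] := ord2P i; rewrite !mxE /=; ring.
move=> x y; apply: enorm_eq; rewrite (dot_frame (x - y) th1) dotE2 !mxE /= -!dotBl.
by have -> : (x - c) - (y - c) = x - y by rewrite opprB addrA subrK.
Qed.

Theorem theorem3p1 (R : realType) (Omega : set 'rV[R]_2) (u : 'rV[R]_2 -> R)
    (x0 : 'rV[R]_2)
    (Omega_open : open Omega)
    (u_semiconcave : semiconcave Omega u)
    (x0_singular : singular_set Omega u x0)
    (x0_boundary : boundary (superdifferential Omega u x0)
                     `\` reachable_gradients Omega u x0 !=set0) :
  exists (A : 'rV[R]_2 -> 'rV[R]_2) (alpha : R) (y1 y2 : R -> R),
    let psi : R -> 'rV[R]_2 := fun x => point2 x (y1 x - y2 x) in
    [/\ cartesian_coordinates A /\ A x0 = point2 0 0,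
        0 < alpha,
        (convex_function `[0, alpha] y1 /\
           [lipschitz y1 x | x in `[0, alpha]]) /\
        (convex_function `[0, alpha] y2 /\
           [lipschitz y2 x | x in `[0, alpha]]),
        psi 0 = point2 0 0
      & A @^-1` (psi @` `[0, alpha]) `<=` singular_set Omega u].
Proof.
have Ox0 : Omega x0 by case: x0_singular.
case: x0_boundary => p []; rewrite /superdifferential.
rewrite (reachable_gradientsE u Omega_open Ox0) => -[clp intp] np.
have [r0 [K [r00 rO cf0]]] := semiconcave_convexify p u_semiconcave Ox0.
set f := convexify p K x0 u in cf0.
have [r [L [rpos rr0 L0 fL GL]]] := convex_lipschitz_ball r00 cf0.
have cf : convex_function (ball x0 r) f.
  move=> t x y /[!inE] xb yb; apply: cf0; rewrite inE.
    exact: le_ball xb.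
  exact: le_ball yb.
have uf x G : isgrad u x G -> isgrad f x (p - G + (2 * K) *: (x - x0)).
  exact: isgrad_convexify.
have cS : compact (limgrad u x0).
  apply: (@compact_limgrad _ _ _ _ r (`|p| + L + `|2 * K| * r)) => //.
  move=> x G xb uG; have xr := (in_ball _ _ _).1 xb.
  have fG := uf _ _ uG; set G' := p - G + _ in fG.
  have -> : G = p - G' + (2 * K) *: (x - x0).
    by apply/rowP => i; rewrite !mxE; ring.
  have G'L : `|G'| <= L by exact: norm_le_dual (GL _ _ xb fG).
  apply: le_trans (ler_normD _ _) _; rewrite normrZ lerD//.
    by apply: le_trans (ler_normB _ _) _; rewrite lerD2l.
  by rewrite ler_wpM2l// ltW.
have [th0 [th0n th0S]] := supporting_direction intp.
have d0 : 0 < dot th0 th0 by rewrite lt_neqAle eq_sym dot_eq0 th0n dot_ge0.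
have en0 : 0 < enorm th0.
  by rewrite lt_neqAle sqrtr_ge0 andbT eq_sym -sqrf_eq0 enorm_sqr gt_eqF.
(* Passing from u to f reverses gradients, hence the sign of the normal. *)
pose theta := - ((enorm th0)^-1 *: th0).
have th1 : dot theta theta = 1.
  rewrite /theta dotNl dotNr opprK dotZl dotZr -enorm_sqr; field.
  by rewrite gt_eqF.
have thS q : limgrad u x0 q -> 0 <= dot (q - p) theta.
  move=> /th0S qp; rewrite /theta dotNr dotZr -mulrN pmulr_rge0 ?invr_gt0//.
  by rewrite oppr_ge0.
clearbody theta.
have thS' q : limgrad u x0 q -> dot (q - p) (- theta) <= 0.
  by move=> /thS; rewrite dotNr oppr_le0.
have flim q : limgrad f x0 q <-> limgrad u x0 (p - q).
  split=> /(limgrad_convexify p K); first by rewrite convexifyK.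
  by rewrite opprB addrCA subrr addr0.
have [e e0 gap] : exists2 e, 0 < e &
    forall x G, `|x - x0| < e -> isgrad f x G -> e <= `|G|.
  have : ~ limgrad f x0 0 by rewrite flim subr0.
  apply: contra_notP => ne e e0; apply: contrapT => nxG; apply: ne.
  exists e => // x G xe fG; rewrite leNgt; apply/negP => Ge.
  by apply: nxG; exists x, G; rewrite subr0.
have fth q : limgrad f x0 q -> dot q theta <= 0.
  move=> /flim/thS; rewrite (_ : p - q - p = - q); last first.
    by rewrite addrAC subrr add0r.
  by rewrite dotNl oppr_ge0.
have [q1 [Sq1 q1th q1p]] := face_point cS clp thS' (- perp theta).
have [q2 [Sq2 q2th q2p]] := face_point cS clp thS' (perp theta).
have Eq q : limgrad u x0 q -> limgrad f x0 (p - q).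
  by move=> uq; apply/flim; rewrite opprB addrCA subrr addr0.
have [||||alpha [y1 [y2 [a0 y00 y1P y2P ridge]]]] :=
  @convex_singular_ridge R f x0 r L e theta (p - q1) (p - q2)
    rpos L0 e0 cf fL GL th1 gap fth (Eq _ Sq1) _ _ (Eq _ Sq2).
- by move: q1th; rewrite dotNr -dotNl opprB.
- by move: q1p; rewrite dotNr -dotNl opprB.
- by move: q2th; rewrite dotNr -dotNl opprB.
- by rewrite -(opprB q2 p) dotNl oppr_le0.
exists (fun x => point2 (dot (x - x0) theta) (dot (x - x0) (perp theta))).
exists alpha, y1, y2 => /=; split=> //.
- split; first exact: frame_coordinates.
  by rewrite subrr !(dotC 0) !dot0r.
- by rewrite y00.
move=> x [t]; rewrite /= in_itv /= => /andP[t0 ta].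
move=> /rowP tx; have := tx 0; have := tx 1; rewrite !mxE /= => xe xt.
have xE : x = x0 + (t *: theta + (y1 t - y2 t) *: perp theta).
  by rewrite xe xt -(frame_decomposition _ th1) addrC subrK.
move: t0; rewrite le_eqVlt => /predU1P[t0|t0].
  by rewrite xE -t0 y00 !scale0r !addr0.
have [xb nG] := ridge t t0 ta; rewrite -xE in xb nG.
split; first by apply: rO; exact: le_ball xb.
move=> du; apply: (nG (p - grad u x + (2 * K) *: (x - x0))).
by apply: uf; apply/isgradP.
Qed.
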